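(* Let $H$ be a separable real Hilbert space. For $x\in H$ and $A\in\mathcal S_2(H)_{\rm sk}$ define $\mathscr E(x,A):=\exp_\wedge(x+2\alpha_A)$. Then: (i) The series belongs to the exterior Fock space $\mathscr F^\wedge(H)$ and $$\|\mathscr E(x,A)\|_{\mathscr F^\wedge}^2\le(1+\|x\|^2)\exp(4\|\alpha_A\|^2).$$ (ii) If $(x,A)\star(y,B)=(x+y,A+B+\operatorname{Anti}(x\otimes y))$, then $$\mathscr E((x,A)\star(y,B))=\mathscr E(x,A)\wedge\mathscr E(y,B).$$ Thus the exterior product is closed on $\mathscr G_2^\wedge(H)=\{\mathscr E(x,A)\}$ and $\mathscr E$ is a topological group isomorphism from the geometric step-two state group $(H\times\mathcal S_2(H)_{\rm sk},\star)$ onto $\mathscr G_2^\wedge(H)$ with its transported topology. Its degree-one and degree-two coordinates recover $x$ and $A$. (iii) Writing $\mathscr E(x,A)=\sum_{k\ge0}\Xi_k(x,A)$ by homogeneous degree, $$\Xi_{2N}(x,A)=\frac{2^N}{N!}\alpha_A^{\wedge N},\qquad\Xi_{2N+1}(x,A)=\frac{2^N}{N!}x\wedge\alpha_A^{\wedge N}.$$ The joint map $(x,A,q)\mapsto(\mathscr E(x,A),q)$ is a continuous lossless group isomorphism from $H\times\mathcal S_2(H)_{\rm sk}\times\mathcal S_1(H)_{\rm sa}$, with product $(x,A,q)\star(y,B,r)=(x+y,A+B+\operatorname{Anti}(x\otimes y),q+r)$, onto $\mathscr G_2^\wedge(H)\times\mathcal S_1(H)_{\rm sa}$, the second factor being additive.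 The covariance channel $q$ is exactly the information forgotten by the exterior factor alone.
   Context: $\mathcal S_1,\mathcal S_2$: trace-class, Hilbert--Schmidt operators; sk, sa: skew-adjoint, self-adjoint; $x\otimes y:h\mapsto\langle y,h\rangle x$; $\operatorname{Anti}U=\frac12(U-U^* )$. $\mathscr F^\wedge(H)=\bigoplus_{k\ge0}^{\ell^2}\bigwedge^kH$ is the Hilbert exterior Fock space, normalized so that for every orthonormal basis $(e_j)$ of $H$ the increasing wedges $e_{i_1}\wedge\cdots\wedge e_{i_k}$ are an orthonormal basis of $\bigwedge^kH$; $\wedge$ is the corresponding exterior multiplication and $\exp_\wedge$ the exponential for it. For $A\in\mathcal S_2(H)_{\rm sk}$, $\alpha_A=\sum_{i<j}\langle Ae_j,e_i\rangle e_i\wedge e_j\in\bigwedge^2H$ (basis independent; $\|\alpha_A\|^2=\frac12\|A\|_{\mathcal S_2}^2$). $\mathscr G_2^\wedge(H)=\{\exp_\wedge(x+2\alpha_A):x\in H,A\in\mathcal S_2(H)_{\rm sk}\}$ carries the topology transported from $H\times\mathcal S_2(H)_{\rm sk}$ through the degree-one and degree-two coordinates. For $u,v\in\mathscr F^\wedge(H)$, $u\wedge v$ denotes the degreewise Cauchy product $w_n=\sum_{i+j=n}u_i\wedge v_j$, used only when it again belongs to $\mathscr F^\wedge(H)$. Lossless: injective with a continuous inverse (decoder) on the image. *)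

(* Defs.v *)
From HB Require Import structures.
From mathcomp Require Import all_boot all_order all_algebra.
From mathcomp Require Import all_classical all_reals all_analysis.
From mathcomp Require Import ring lra.

Set Implicit Arguments.
Unset Strict Implicit.
Unset Printing Implicit Defensive.

Import Order.TTheory GRing.Theory Num.Theory.
Import numFieldNormedType.Exports.
Local Open Scope classical_set_scope.
Local Open Scope ring_scope.

HB.mixin Record isHilbert (R : realType) H & CompleteNormedModule R H := {
  dot : H -> H -> R ;
  dotC : forall x y, dot x y = dot y x ;
  dot_linear : forall (a : R) (x y z : H),
    dot (a *: x + y) z = a * dot x z + dot y z ;
  dot_norm : forall x, dot x x = `|x| ^+ 2
}.

#[short(type="hilbertType")]
HB.structure Definition Hilbert (R : realType) :=
  {H of isHilbert R H & CompleteNormedModule R H}.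

Definition separable (T : topologicalType) :=
  exists2 D : set T, countable D & dense D.

Section dot_theory.
Variables (R : realType) (H : hilbertType R).
Implicit Types (x y z : H) (a : R).

Lemma dotDl x y z : dot (x + y) z = dot x z + dot y z.
Proof. by have := dot_linear 1 x y z; rewrite scale1r mul1r. Qed.

Lemma dot0l z : dot 0 z = 0.
Proof. by have := dotDl 0 0 z; rewrite addr0; lra. Qed.

Lemma dotZl a x z : dot (a *: x) z = a * dot x z.
Proof. by have := dot_linear a x 0 z; rewrite dot0l !addr0. Qed.

Lemma dotNl x z : dot (- x) z = - dot x z.
Proof. by rewrite -scaleN1r dotZl mulN1r. Qed.

Lemma dotBl x y z : dot (x - y) z = dot x z - dot y z.
Proof. by rewrite dotDl dotNl. Qed.

Lemma dotDr x y z : dot z (x + y) = dot z x + dot z y.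
Proof. by rewrite dotC dotDl !(dotC z). Qed.

Lemma dotZr a x z : dot z (a *: x) = a * dot z x.
Proof. by rewrite dotC dotZl (dotC z). Qed.

Lemma dot0r z : dot z 0 = 0.
Proof. by rewrite dotC dot0l. Qed.

Lemma dotNr x z : dot z (- x) = - dot z x.
Proof. by rewrite dotC dotNl (dotC z). Qed.

Lemma dotBr x y z : dot z (x - y) = dot z x - dot z y.
Proof. by rewrite dotDr dotNr. Qed.

Lemma dot_suml (I : Type) (r : seq I) (P : pred I) (F : I -> H) z :
  dot (\sum_(i <- r | P i) F i) z = \sum_(i <- r | P i) dot (F i) z.
Proof.
by elim/big_rec2: _ => [|i u v _ <-]; rewrite ?dot0l ?dotDl.
Qed.

Lemma dot_sumr (I : Type) (r : seq I) (P : pred I) (F : I -> H) z :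
  dot z (\sum_(i <- r | P i) F i) = \sum_(i <- r | P i) dot z (F i).
Proof. by rewrite dotC dot_suml; apply: eq_bigr => i _; rewrite dotC. Qed.

Lemma dot_inj x y : (forall z, dot z x = dot z y) -> x = y.
Proof.
move=> xy; apply/eqP; rewrite -subr_eq0 -normr_eq0 -sqrf_eq0 -dot_norm.
by rewrite dotBr xy subrr.
Qed.

Definition orthonormal n (f : 'I_n -> H) :=
  forall i j, dot (f i) (f j) = (i == j)%:R.

Lemma bessel n (f : 'I_n -> H) x : orthonormal f ->
  \sum_i dot x (f i) ^+ 2 <= `|x| ^+ 2.
Proof.
move=> fo; pose p := \sum_i dot x (f i) *: f i.
have xp : dot x p = \sum_i dot x (f i) ^+ 2.
  by rewrite dot_sumr; apply: eq_bigr => i _; rewrite dotZr expr2.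
have pp : dot p p = \sum_i dot x (f i) ^+ 2.
  rewrite [in LHS]/p dot_suml; apply: eq_bigr => i _; rewrite dotZl expr2.
  congr (_ * _); rewrite dot_sumr (bigD1 i)//= dotZr fo eqxx mulr1.
  rewrite big1 ?addr0// => j ji.
  by rewrite dotZr fo eq_sym (negbTE ji) mulr0.
have : 0 <= dot (x - p) (x - p) by rewrite dot_norm exprn_ge0.
rewrite !(dotBl, dotBr) (dotC p x) xp pp dot_norm; lra.
Qed.

Lemma normr_le_orthonormal x (c : R) : 0 <= c ->
  (forall f : 'I_1 -> H, orthonormal f -> dot x (f ord0) <= c) -> `|x| <= c.
Proof.
move=> c0 xc; have [->|x0] := eqVneq x 0; first by rewrite normr0.
have n0 : `|x| != 0 by rewrite normr_eq0.
pose f := fun _ : 'I_1 => `|x|^-1 *: x.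
have fo : orthonormal f.
  by move=> i j; rewrite !ord1 eqxx dotZl dotZr dot_norm expr2 mulKf ?mulVf.
have := xc f fo; rewrite dotZr dot_norm expr2 mulrA mulVf ?mul1r//.
Qed.

End dot_theory.

Section orthonormal_basis.
Variables (R : realType) (H : hilbertType R).

(* A Hilbert basis indexed by the j with [e j <> 0]: padding with zero vectors
   covers finite and infinite dimension at once, and the padded terms do not
   contribute to any of the sums over a basis below. *)
Definition orthonormal_basis (e : nat -> H) :=
  [/\ forall i j, i != j -> dot (e i) (e j) = 0,
      forall j, e j = 0 \/ `|e j| = 1 &
      forall x, (fun n => \sum_(j < n) dot x (e j) *: e j) @ \oo --> x].

Let proj (e : nat -> H) n x := \sum_(j < n) dot x (e j) *: e j.

Let normr_sub_proj (e : nat -> H) n x :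
  (forall i j, (i < n)%N -> (j < n)%N -> i != j -> dot (e i) (e j) = 0) ->
  (forall j, (j < n)%N -> e j = 0 \/ `|e j| = 1) ->
  `|x - proj e n x| <= `|x|.
Proof.
move=> eo e1.
have xp : dot x (proj e n x) = \sum_(j < n) dot x (e j) ^+ 2.
  by rewrite dot_sumr; apply: eq_bigr => i _; rewrite dotZr expr2.
have pp : dot (proj e n x) (proj e n x) = \sum_(j < n) dot x (e j) ^+ 2.
  rewrite [in LHS]/proj dot_suml; apply: eq_bigr => i _; rewrite dotZl expr2.
  congr (_ * _); rewrite dot_sumr (bigD1 i)//= dotZr dot_norm.
  rewrite big1 ?addr0 => [|j ji]; last by rewrite dotZr eo ?mulr0// eq_sym.
  by have [->|->] := e1 i (ltn_ord i); rewrite ?dot0r ?mul0r// expr1n mulr1.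
rewrite -ler_sqr ?nnegrE// -!dot_norm !(dotBl, dotBr) (dotC (proj _ _ _) x).
rewrite xp pp.
have : 0 <= \sum_(j < n) dot x (e j) ^+ 2.
  by apply: sumr_ge0 => i _; exact: sqr_ge0.
lra.
Qed.

Lemma separable_orthonormal_basis :
  separable H -> exists e : nat -> H, orthonormal_basis e.
Proof.
case=> D cD dD.
have [d dE] : exists d : nat -> H, forall y, D y -> exists n, d n = y.
  have /pfcard_geP[D0|[d]] : (D #<= [set: nat])%card by [].
    by exists (fun=> 0) => y; rewrite D0.
  by exists d => y /(@surj _ _ _ _ d)[n _ ny]; exists n.
pose nrm (v : H) := `|v|^-1 *: v.
pose res (g : nat -> H) n := d n - proj g n (d n).
pose G := fix G n : nat -> H := if n is n'.+1 then
  fun k => if k == n' then nrm (res (G n') n') else G n' k else fun=> 0.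
pose e k := G k.+1 k.
have GE n k : (k < n)%N -> G n k = e k.
  elim: n => // n IH; rewrite ltnS leq_eqVlt => /orP[/eqP -> //|kn] /=.
  by rewrite ltn_eqF// IH.
have eE n : e n = nrm (res e n).
  rewrite /e /= eqxx; congr nrm; congr (_ - _); apply: eq_bigr => j _.
  by rewrite GE.
have e01 n : e n = 0 \/ `|e n| = 1.
  rewrite eE /nrm; have [->|r0] := eqVneq (res e n) 0.
    by left; rewrite scaler0.
  by right; rewrite normrZ normfV normr_id mulVf// normr_eq0.
have dot_proj (x : H) n i : (i < n)%N ->
    (forall j, (j < n)%N -> j != i -> dot (e j) (e i) = 0) ->
    dot (proj e n x) (e i) = dot x (e i).
  move=> ni o; rewrite dot_suml (bigD1 (Ordinal ni))//= dotZl dot_norm.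
  rewrite big1 ?addr0 => [|j ji]; last by rewrite dotZl o ?mulr0.
  by have [->|->] := e01 i; rewrite ?dot0r ?mul0r// expr1n mulr1.
have o1 n : forall i, (i < n)%N -> dot (e n) (e i) = 0.
  elim/ltn_ind: n => n IH i ni.
  rewrite eE dotZl dotBl dot_proj ?subrr ?mulr0// => j jn.
  rewrite neq_ltn => /orP[ji|ij]; last exact: IH.
  by rewrite dotC IH.
have eo i j : i != j -> dot (e i) (e j) = 0.
  by rewrite neq_ltn => /orP[ij|ji]; [rewrite dotC|]; exact: o1.
have pd1 n : proj e n.+1 (d n) = d n.
  rewrite /proj big_ord_recr/= -/(proj e n (d n)).
  rewrite -[RHS](subrK (proj e n (d n))) addrC; congr (_ + _).
  rewrite -/(res e n).
  have -> : dot (d n) (e n) = dot (res e n) (e n).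
    rewrite dotBl [X in _ - X]dot_suml big1 ?subr0// => j _.
    by rewrite dotZl (dotC (e j)) o1 ?mulr0.
  rewrite eE /nrm dotZr dot_norm scalerA.
  have [->|r0] := eqVneq (res e n) 0; first by rewrite scaler0.
  by rewrite expr2 mulKf ?normr_eq0// mulfV ?normr_eq0// scale1r.
have pd n m : (n < m)%N -> proj e m (d n) = d n.
  elim: m => // m IH; rewrite ltnS leq_eqVlt => /orP[/eqP <-|nm].
    exact: pd1.
  rewrite /proj big_ord_recr/= -/(proj e m (d n)) IH// -[in dot _ _]IH//.
  rewrite dot_suml big1 ?scale0r ?addr0// => j _.
  by rewrite dotZl eo ?mulr0// neq_ltn ltn_ord.
exists e; split => // x.
apply/cvgrPdist_le => eps eps0.
have [y [] xy /dE[n ny]] : (ball x eps `&` D) !=set0.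
  rewrite setIC setIC; apply: dD; first by exists x; exact: ballxx.
  exact: ball_open.
near=> m.
have nm : (n < m)%N by near: m; exact: nbhs_infty_gt.
have -> : x - \sum_(j < m) dot x (e j) *: e j =
          (x - d n) - proj e m (x - d n).
  have -> : proj e m (x - d n) = proj e m x - proj e m (d n).
    rewrite /proj -sumrB; apply: eq_bigr => j _.
    by rewrite dotBl scalerBl.
  by rewrite pd// opprB addrA subrK.
apply: le_trans (normr_sub_proj (x - d n) _ _) _ => // [i j _ _|].
  exact: eo.
rewrite ny; move: xy; rewrite -ball_normE/= => /ltW; apply.
Unshelve. all: by end_near.
Qed.

End orthonormal_basis.

Section operators.
Variables (R : realType) (H : hilbertType R).
Implicit Types (A B U T : H -> H).

Definition tensor (x y : H) : H -> H := fun h => dot y h *: x.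

Definition adjoint U : H -> H :=
  fun k => xget 0 [set z | forall h, dot (U h) k = dot h z].

Definition Anti U : H -> H := fun h => 2^-1 *: (U h - adjoint U h).

(* The Hilbert-Schmidt and trace norms are computed as suprema over finite
   orthonormal families; an operator is in S_2 (resp. S_1) when the supremum is
   finite, which forces it to be bounded. *)
Definition hs_sums A : set R :=
  [set s | exists n (f : 'I_n -> H),
     orthonormal f /\ s = \sum_i `|A (f i)| ^+ 2].

Definition hs_norm A : R := Num.sqrt (sup (hs_sums A)).

Definition tr_sums T : set R :=
  [set s | exists n (f g : 'I_n -> H),
     [/\ orthonormal f, orthonormal g & s = \sum_i `|dot (T (f i)) (g i)|]].

Definition tr_norm T : R := sup (tr_sums T).

Definition skew_adjoint A := forall h k, dot (A h) k = - dot h (A k).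
Definition self_adjoint T := forall h k, dot (T h) k = dot h (T k).

Definition is_S2sk A :=
  [/\ linear A, skew_adjoint A & has_ubound (hs_sums A)].
Definition is_S1sa T :=
  [/\ linear T, self_adjoint T & has_ubound (tr_sums T)].

Definition S2sk_pred : {pred H -> H} := fun A => `[< is_S2sk A >].
Definition S1sa_pred : {pred H -> H} := fun T => `[< is_S1sa T >].

Lemma S2skP A : reflect (is_S2sk A) (A \in S2sk_pred).
Proof. exact: asboolP. Qed.

Lemma S1saP A : reflect (is_S1sa A) (A \in S1sa_pred).
Proof. exact: asboolP. Qed.

Lemma hs_sums0 A : hs_sums A 0.
Proof.
exists 0%N, (fun=> 0); split; last by rewrite big_ord0.
by case.
Qed.

Lemma tr_sums0 T : tr_sums T 0.
Proof.
by exists 0%N, (fun=> 0), (fun=> 0); split; rewrite ?big_ord0//; case.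
Qed.

Lemma hs_sup_ge0 A : has_ubound (hs_sums A) -> 0 <= sup (hs_sums A).
Proof. by move=> hA; apply: ub_le_sup => //; exact: hs_sums0. Qed.

Lemma sqr_hs_norm A : has_ubound (hs_sums A) ->
  hs_norm A ^+ 2 = sup (hs_sums A).
Proof. by move=> hA; rewrite sqr_sqrtr// hs_sup_ge0. Qed.

Lemma hs_norm_ge A n (f : 'I_n -> H) : has_ubound (hs_sums A) ->
  orthonormal f -> \sum_i `|A (f i)| ^+ 2 <= hs_norm A ^+ 2.
Proof.
move=> hA fo; rewrite sqr_hs_norm//; apply: ub_le_sup => //.
by exists n, f.
Qed.

Lemma hs_norm_le A c : 0 <= c ->
  (forall n (f : 'I_n -> H), orthonormal f ->
    \sum_i `|A (f i)| ^+ 2 <= c ^+ 2) -> hs_norm A <= c.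
Proof.
move=> c0 Ac; rewrite -[leRHS]ger0_norm// -sqrtr_sqr ler_wsqrtr//.
apply: ge_sup; first by exists 0; exact: hs_sums0.
by move=> _ [n [f [fo ->]]]; exact: Ac.
Qed.

Lemma minkowski_sum n (a b : 'I_n -> R) (p q : R) :
  0 <= p -> 0 <= q -> \sum_i a i ^+ 2 <= p ^+ 2 -> \sum_i b i ^+ 2 <= q ^+ 2 ->
  \sum_i (a i + b i) ^+ 2 <= (p + q) ^+ 2.
Proof.
move=> p0 q0 ap bq.
have vanish (c : 'I_n -> R) (r : R) : r = 0 -> \sum_i c i ^+ 2 <= r ^+ 2 ->
    forall i, c i = 0.
  move=> -> ; rewrite expr0n/= => c0 i; apply/eqP; rewrite -sqrf_eq0.
  rewrite eq_le sqr_ge0 andbT (le_trans _ c0)//.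
  by rewrite (bigD1 i)//= lerDl sumr_ge0// => j _; exact: sqr_ge0.
have [pE|pn0] := eqVneq p 0.
  rewrite pE add0r (le_trans _ bq)// ler_sum// => i _.
  by rewrite (vanish a p pE ap) add0r.
have [qE|qn0] := eqVneq q 0.
  rewrite qE addr0 (le_trans _ ap)// ler_sum// => i _.
  by rewrite (vanish b q qE bq) addr0.
have {p0}p0 : 0 < p by rewrite lt_neqAle eq_sym pn0.
have {q0}q0 : 0 < q by rewrite lt_neqAle eq_sym qn0.
pose r := q / p.
have r0 : 0 < r by rewrite divr_gt0.
apply: (@le_trans _ _
  (\sum_i ((1 + r) * a i ^+ 2 + (1 + r^-1) * b i ^+ 2))).
  apply: ler_sum => i _.
  have : 0 <= r^-1 * (r * a i - b i) ^+ 2 by rewrite mulr_ge0 ?sqr_ge0// invr_ge0 ltW.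
  have -> : r^-1 * (r * a i - b i) ^+ 2 =
            r * a i ^+ 2 - 2 * a i * b i + r^-1 * b i ^+ 2.
    by field; exact: lt0r_neq0.
  nra.
rewrite big_split/= -!mulr_sumr.
have -> : (p + q) ^+ 2 = (1 + r) * p ^+ 2 + (1 + r^-1) * q ^+ 2.
  by rewrite /r; field; rewrite pn0 qn0.
by rewrite lerD// ler_wpM2l// addr_ge0// ?invr_ge0 ltW.
Qed.

Lemma hs_sum_add A B n (f : 'I_n -> H) :
  has_ubound (hs_sums A) -> has_ubound (hs_sums B) -> orthonormal f ->
  \sum_i `|(A + B) (f i)| ^+ 2 <= (hs_norm A + hs_norm B) ^+ 2.
Proof.
move=> hA hB fo.
apply: le_trans (minkowski_sum (sqrtr_ge0 _) (sqrtr_ge0 _)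
  (hs_norm_ge hA fo) (hs_norm_ge hB fo)).
apply: ler_sum => i _; rewrite ler_sqr ?nnegrE ?addr_ge0//.
exact: ler_normD.
Qed.

Lemma hs_sum_scale a A n (f : 'I_n -> H) :
  has_ubound (hs_sums A) -> orthonormal f ->
  \sum_i `|(a *: A) (f i)| ^+ 2 <= (`|a| * hs_norm A) ^+ 2.
Proof.
move=> hA fo.
under eq_bigr => i _ do rewrite normrZ exprMn.
by rewrite -mulr_sumr exprMn ler_wpM2l ?sqr_ge0// hs_norm_ge.
Qed.

Lemma S2sk_submod_closed : submod_closed S2sk_pred.
Proof.
split=> [|a A B /S2skP[lA sA hA] /S2skP[lB sB hB]]; apply/S2skP; split.
- by move=> a x y; rewrite /= scaler0 addr0.
- by move=> h k; rewrite dot0l dot0r oppr0.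
- exists 0 => _ [n [f [fo ->]]]; rewrite big1// => i _.
  by rewrite normr0 expr0n.
- move=> c x y /=.
  by rewrite !fctE lA lB !scalerDr addrACA !scalerA mulrC.
- move=> h k; rewrite !fctE dotDl dotDr dotZl dotZr sA sB; ring.
- have haA : has_ubound (hs_sums (a *: A)).
    by exists ((`|a| * hs_norm A) ^+ 2) => _ [n [f [fo ->]]]; exact: hs_sum_scale.
  exists ((hs_norm (a *: A) + hs_norm B) ^+ 2) => _ [n [f [fo ->]]].
  exact: hs_sum_add.
Qed.

Lemma tr_norm_ge T n (f g : 'I_n -> H) : has_ubound (tr_sums T) ->
  orthonormal f -> orthonormal g ->
  \sum_i `|dot (T (f i)) (g i)| <= tr_norm T.
Proof. by move=> hT fo go; apply: ub_le_sup => //; exists n, f, g. Qed.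

Lemma tr_norm_le T c :
  (forall n (f g : 'I_n -> H), orthonormal f -> orthonormal g ->
    \sum_i `|dot (T (f i)) (g i)| <= c) -> tr_norm T <= c.
Proof.
move=> Tc; apply: ge_sup; first by exists 0; exact: tr_sums0.
by move=> _ [n [f [g [fo go ->]]]]; exact: Tc.
Qed.

Lemma tr_sum_add S T n (f g : 'I_n -> H) :
  has_ubound (tr_sums S) -> has_ubound (tr_sums T) ->
  orthonormal f -> orthonormal g ->
  \sum_i `|dot ((S + T) (f i)) (g i)| <= tr_norm S + tr_norm T.
Proof.
move=> hS hT fo go.
apply: le_trans (lerD (tr_norm_ge hS fo go) (tr_norm_ge hT fo go)).
by rewrite -big_split ler_sum// => i _; rewrite dotDl; exact: ler_normD.
Qed.

Lemma tr_sum_scale a T n (f g : 'I_n -> H) :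
  has_ubound (tr_sums T) -> orthonormal f -> orthonormal g ->
  \sum_i `|dot ((a *: T) (f i)) (g i)| <= `|a| * tr_norm T.
Proof.
move=> hT fo go.
under eq_bigr => i _ do rewrite dotZl normrM.
by rewrite -mulr_sumr ler_wpM2l// tr_norm_ge.
Qed.

Lemma S1sa_submod_closed : submod_closed S1sa_pred.
Proof.
split=> [|a A B /S1saP[lA sA hA] /S1saP[lB sB hB]]; apply/S1saP; split.
- by move=> a x y; rewrite /= scaler0 addr0.
- by move=> h k; rewrite dot0l dot0r.
- exists 0 => _ [n [f [g [fo go ->]]]]; rewrite big1// => i _.
  by rewrite dot0l normr0.
- move=> c x y /=.
  by rewrite !fctE lA lB !scalerDr addrACA !scalerA mulrC.
- by move=> h k; rewrite !fctE dotDl dotDr dotZl dotZr sA sB.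
- have haA : has_ubound (tr_sums (a *: A)).
    exists (`|a| * tr_norm A) => _ [n [f [g [fo go ->]]]].
    exact: tr_sum_scale.
  exists (tr_norm (a *: A) + tr_norm B) => _ [n [f [g [fo go ->]]]].
  exact: tr_sum_add.
Qed.

HB.instance Definition _ :=
  GRing.isSubmodClosed.Build R (H -> H) S2sk_pred S2sk_submod_closed.
HB.instance Definition _ :=
  GRing.isSubmodClosed.Build R (H -> H) S1sa_pred S1sa_submod_closed.

Lemma adjoint_tensor x y : adjoint (tensor x y) = tensor y x.
Proof.
apply/funext => k; rewrite /adjoint.
have E h : dot (tensor x y h) k = dot h (tensor y x k).
  by rewrite dotZl dotZr (dotC h) mulrC.
case: xgetP => [z _ zP|/(_ (tensor y x k))[]//].
by apply: dot_inj => h; rewrite -E zP.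
Qed.

Lemma Anti_tensorE x y h :
  Anti (tensor x y) h = 2^-1 *: (dot y h *: x - dot x h *: y).
Proof. by rewrite /Anti adjoint_tensor. Qed.

Lemma Anti_tensor_S2sk x y : Anti (tensor x y) \in S2sk_pred.
Proof.
apply/S2skP; split.
- move=> a h k; rewrite !Anti_tensorE !dotDr !dotZr.
  rewrite [a *: (_ *: _)]scalerA (mulrC a 2^-1) -scalerA -scalerDr.
  congr (_ *: _).
  rewrite !scalerDl scalerBr !scalerA opprD.
  by rewrite addrACA.
- move=> h k; rewrite !Anti_tensorE !(dotZl, dotZr, dotBl, dotBr).
  rewrite (dotC h x) (dotC h y); ring.
- exists (`|x| ^+ 2 * `|y| ^+ 2) => _ [n [f [fo ->]]].
  apply: (@le_trans _ _ (2^-1 * (`|x| ^+ 2 * \sum_i dot y (f i) ^+ 2 +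
                                 `|y| ^+ 2 * \sum_i dot x (f i) ^+ 2))).
    rewrite !mulr_sumr -big_split mulr_sumr ler_sum// => i _ /=.
    rewrite Anti_tensorE normrZ exprMn.
    set u := dot y (f i) *: x; set v := dot x (f i) *: y.
    have uE : `|u| ^+ 2 = `|x| ^+ 2 * dot y (f i) ^+ 2.
      by rewrite normrZ exprMn real_normK ?num_real// mulrC.
    have vE : `|v| ^+ 2 = `|y| ^+ 2 * dot x (f i) ^+ 2.
      by rewrite normrZ exprMn real_normK ?num_real// mulrC.
    rewrite -uE -vE ger0_norm ?invr_ge0//.
    have : 0 <= `|u + v| ^+ 2 by rewrite exprn_ge0.
    rewrite -!dot_norm !(dotDl, dotDr, dotNl, dotNr) (dotC v u); lra.
  have := ler_wpM2l (sqr_ge0 `|x|) (bessel y fo).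
  have := ler_wpM2l (sqr_ge0 `|y|) (bessel x fo).
  lra.
Qed.

End operators.

Record S2sk (R : realType) (H : hilbertType R) := MkS2sk {
  S2sk_val :> H -> H ; S2sk_valP : S2sk_val \in @S2sk_pred R H }.
Record S1sa (R : realType) (H : hilbertType R) := MkS1sa {
  S1sa_val :> H -> H ; S1sa_valP : S1sa_val \in @S1sa_pred R H }.

Section operator_spaces.
Variables (R : realType) (H : hilbertType R).

HB.instance Definition _ := [isSub for @S2sk_val R H].
HB.instance Definition _ := [Choice of S2sk H by <:].
HB.instance Definition _ := [SubChoice_isSubLmodule of S2sk H by <:].
HB.instance Definition _ := [isSub for @S1sa_val R H].
HB.instance Definition _ := [Choice of S1sa H by <:].
HB.instance Definition _ := [SubChoice_isSubLmodule of S1sa H by <:].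

Let S2sk_ub (A : S2sk H) : has_ubound (hs_sums A).
Proof. by have /S2skP[] := S2sk_valP A. Qed.

Let S1sa_ub (A : S1sa H) : has_ubound (tr_sums A).
Proof. by have /S1saP[] := S1sa_valP A. Qed.

Lemma S2sk_normD (A B : S2sk H) :
  hs_norm (A + B : S2sk H) <= hs_norm A + hs_norm B.
Proof.
apply: hs_norm_le; first by rewrite addr_ge0// sqrtr_ge0.
by move=> n f fo; exact: (hs_sum_add (S2sk_ub A) (S2sk_ub B)).
Qed.

Lemma S1sa_normD (A B : S1sa H) :
  tr_norm (A + B : S1sa H) <= tr_norm A + tr_norm B.
Proof.
apply: tr_norm_le => n f g fo go.
exact: (tr_sum_add (S1sa_ub A) (S1sa_ub B)).
Qed.

Let homogeneous (V : lmodType R) (N : V -> R) :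
  (forall a v, N (a *: v) <= `|a| * N v) -> N 0 = 0 ->
  forall a v, N (a *: v) = `|a| * N v.
Proof.
move=> le N0 a v; apply/eqP; rewrite eq_le le/=.
have [->|a0] := eqVneq a 0; first by rewrite normr0 mul0r scale0r N0.
have := le a^-1 (a *: v); rewrite scalerA mulVf// scale1r normfV.
by rewrite mulrC ler_pdivlMr ?normr_gt0// mulrC.
Qed.

Lemma S2sk_normZ a (A : S2sk H) : hs_norm (a *: A : S2sk H) = `|a| * hs_norm A.
Proof.
apply: (homogeneous (N := fun A : S2sk H => hs_norm A)) => {a A} [a A|].
  apply: hs_norm_le; first by rewrite mulr_ge0// sqrtr_ge0.
  by move=> n f fo; exact: (hs_sum_scale a (S2sk_ub A)).
apply/eqP; rewrite eq_le sqrtr_ge0 andbT; apply: hs_norm_le => // n f fo.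
by rewrite big1 ?expr0n// => i _; rewrite normr0 expr0n.
Qed.

Lemma S1sa_normZ a (A : S1sa H) : tr_norm (a *: A : S1sa H) = `|a| * tr_norm A.
Proof.
apply: (homogeneous (N := fun A : S1sa H => tr_norm A)) => {a A} [a A|].
  by apply: tr_norm_le => n f g fo go; exact: (tr_sum_scale a (S1sa_ub A)).
apply/eqP; rewrite eq_le; apply/andP; split.
  apply: tr_norm_le => // n f g fo go.
  by rewrite big1// => i _; rewrite dot0l normr0.
by apply: ub_le_sup; [exact: S1sa_ub|exact: tr_sums0].
Qed.

Lemma S2sk_norm_eq0 (A : S2sk H) : hs_norm A = 0 -> A = 0.
Proof.
move=> A0; apply/val_inj/funext => h /=.
have lA : linear A by have /S2skP[] := S2sk_valP A.
have sA : skew_adjoint A by have /S2skP[] := S2sk_valP A.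
apply/eqP; rewrite -normr_le0; apply: normr_le_orthonormal => // f fo.
suff Af : A (f ord0) = 0 by rewrite sA Af dot0r oppr0.
have := hs_norm_ge (S2sk_ub A) fo; rewrite big_ord1 A0 expr0n/= => le0.
by apply/eqP; rewrite -normr_eq0 -sqrf_eq0 eq_le le0 sqr_ge0.
Qed.

Lemma S1sa_norm_eq0 (A : S1sa H) : tr_norm A = 0 -> A = 0.
Proof.
move=> A0; apply/val_inj/funext => h /=.
have sA : self_adjoint A by have /S1saP[] := S1sa_valP A.
apply/eqP; rewrite -normr_le0; apply: normr_le_orthonormal => // f fo.
suff Af : A (f ord0) = 0 by rewrite sA Af dot0r.
apply/eqP; rewrite -normr_le0; apply: normr_le_orthonormal => // g go.
apply: le_trans (ler_norm _) _.
by have := tr_norm_ge (S1sa_ub A) fo go; rewrite big_ord1 A0.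
Qed.

HB.instance Definition _ :=
  Lmodule_isNormed.Build R (S2sk H) S2sk_normD S2sk_normZ S2sk_norm_eq0.
HB.instance Definition _ :=
  Lmodule_isNormed.Build R (S1sa H) S1sa_normD S1sa_normZ S1sa_norm_eq0.

Definition Anti_tensor (x y : H) : S2sk H := MkS2sk (Anti_tensor_S2sk x y).

Definition star (p q : H * S2sk H) : H * S2sk H :=
  (p.1 + q.1, p.2 + q.2 + Anti_tensor p.1 q.1).

Definition star3 (s t : H * S2sk H * S1sa H) : H * S2sk H * S1sa H :=
  (star s.1 t.1, s.2 + t.2).

End operator_spaces.

Section exterior_fock.
Variables (R : realType) (H : hilbertType R).

(* An element [u = \sum_k u_k] of the exterior algebra is encoded by the
   alternating forms [(h_1, ..., h_k) |-> <u_k, h_1 /\ ... /\ h_k>]; the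
   component of degree [k] is the restriction of [u] to sequences of size [k].
   In particular x_1 /\ ... /\ x_k is the form det (<x_i, h_j>). *)
Local Notation form := (seq H -> R).
Implicit Types (u v : form) (e : nat -> H).

Definition multilinear u := forall s t (a : R) (x y : H),
  u (s ++ (a *: x + y) :: t) = a * u (s ++ x :: t) + u (s ++ y :: t).

Definition alternating u := forall s t r (x : H), u (s ++ x :: t ++ x :: r) = 0.

Definition bounded_form u := forall k, exists C : R,
  forall s, size s = k -> `|u s| <= C * \prod_(x <- s) `|x|.

(* [u [seq e j | j <- i]] is the coordinate of [u] on the increasing wedge
   e_{i_1} /\ ... /\ e_{i_k}. *)
Definition fock_sqnorm e u : \bar R :=
  \esum_(i in [set i : seq nat | sorted ltn i])
     ((u [seq e j | j <- i]) ^+ 2)%:E.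

Definition fock e : set form := [set u |
  [/\ multilinear u, alternating u, bounded_form u &
      (fock_sqnorm e u < +oo)%E]].

Definition hcomp k u : form := fun s => if size s == k then u s else 0.

Fixpoint inversions (m : bitseq) : nat :=
  if m is b :: m' then ((if b then 0 else count id m') + inversions m')%N
  else 0%N.

(* Shuffle product: [m] selects the arguments passed to [u], the others go to
   [v], and [inversions m] is the number of inversions of that shuffle. The
   masks with [i] true entries give the term u_i /\ v_j of the Cauchy product. *)
Definition wedge u v : form := fun s =>
  \sum_(m : (size s).-tuple bool)
     (-1) ^+ inversions m * u (mask m s) * v (mask (map negb m) s).

Definition form1 : form := fun s => (nilp s)%:R.

Definition vec (x : H) : form := fun s => if s is [:: h] then dot x h else 0.

Definition wpow u n : form := iter n (wedge u) form1.

(* \sum_(i < j) <A e_j, e_i> e_i /\ e_j, summed pointwise on the arguments. *)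
Definition alpha e (A : H -> H) : form := fun s =>
  limn (fun n => \sum_(j < n) \sum_(i < j)
    dot (A (e j)) (e i) * wedge (vec (e i)) (vec (e j)) s).

Definition exp_terms u (n : nat) : form := (n`!%:R^-1 : R) *: wpow u n.

(* When [u] has no component of degree 0, only the terms [n <= size s]
   contribute, so the series is a finite sum in each degree. *)
Definition wexp u : form := fun s => limn (series (fun n => exp_terms u n s)).

Definition generator e (p : H * S2sk H) : form :=
  vec p.1 + (2 : R) *: alpha e p.2.

Definition Enc e (p : H * S2sk H) : form := wexp (generator e p).

Definition G2_set e : set form := range (Enc e).

(* The point (x, A) read off from the components of degree one and two. *)
Definition coord12 e u : H * S2sk H :=
  (xget 0 [set x | hcomp 1%N u = vec x],
   xget 0 [set A : S2sk H | hcomp 2%N u = (2 : R) *: alpha e A]).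

Definition G2 e := initial_topology (fun u : G2_set e => coord12 e (val u)).

Definition G2_val e (g : G2 e) : form := val (g : G2_set e).

Definition G2_enc e (p : H * S2sk H) : G2 e :=
  exist _ (Enc e p) (mem_set (imageT (Enc e) p)).

End exterior_fock.

Section topological_groups.

Definition topological_group (T : topologicalType) (mul : T -> T -> T) :=
  associative mul /\
  exists (one : T) (inv : T -> T),
    [/\ left_id one mul, right_id one mul,
        left_inverse one inv mul & right_inverse one inv mul] /\
    continuous (fun p : T * T => mul p.1 p.2) /\ continuous inv.

Definition lossless (T U : topologicalType) (f : T -> U) :=
  injective f /\ exists2 g : U -> T, cancel f g & {within range f, continuous g}.

Definition topological_group_iso (T U : topologicalType)
    (mulT : T -> T -> T) (mulU : U -> U -> U) (f : T -> U) :=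
  [/\ topological_group mulT, topological_group mulU,
      {morph f : p q / mulT p q >-> mulU p q}, bijective f &
      continuous f /\ lossless f].

End topological_groups.

(* Main.v *)
Require Import Defs.
From mathcomp Require Import all_boot all_order all_algebra.
From mathcomp Require Import all_classical all_reals all_analysis.
From mathcomp Require Import ring lra zify.

Set Implicit Arguments.
Unset Strict Implicit.
Unset Printing Implicit Defensive.

Import Order.TTheory GRing.Theory Num.Theory.
Import numFieldNormedType.Exports.
Local Open Scope classical_set_scope.
Local Open Scope ring_scope.

(** The proof is elementary algebra of forms; no spectral theory enters.

    Splitting a shuffle according to the factor that receives the first argument
    shows that the interior products [contract h] are antiderivations of the
    exterior product ([contract_wedge]). As a form is determined by its constant
    term and its contractions, associativity, graded commutativity and the other
    identities follow by induction on the arguments.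

    By continuity of [A] the series defining [alpha e A] sums to the form
    (h, k) |-> <A k, h> ([alphaE]). The form b = 2 alpha is even, hence commutes
    with every form, while x /\ x = 0; so exp (x + b) = exp b + x /\ exp b
    ([wexp_vecD]). Reading off the homogeneous components gives the formulas of
    part (iii), and the components of degrees one and two determine x and A.

    The exponential of an even form b is the solution G, with constant term 1,
    of the differential equation contract h G = (contract h b) /\ G, which is
    unique ([contract_unique]). It follows that exp (b + c) = exp b /\ exp c and
    exp (x /\ y) = 1 + x /\ y. Since twice the form of Anti (x (x) y) is x /\ y
    ([double_alpha_Anti_tensor]), multiplicativity of the encoding comes down to
    (1 + x + y) (1 + x y) = (1 + x) (1 + y) ([wexp_vecD_mul]).

    The Fock norm is the supremum of its restrictions to finitely many basis
    vectors ([fock_sqnormE]). There the creation operator x /\ _ is adjoint to the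
    annihilation operator of x, and their anticommutation relation bounds it by
    |x| ([sublist_dot_vec_wedge_le]). Adding one basis vector h multiplies the
    squared norm of exp b by at most 1 + |w|^2, where the vector w represents
    contract h b, and adds |w|^2 to the squared norm of b. Thus
    |exp b|^2 <= exp |b|^2 ([sublist_dot_wexp_le]), which is the estimate of
    part (i) for x = 0; the orthogonal odd part x /\ exp b contributes the factor
    1 + |x|^2. The partial sums of the exponential series are truncations by
    degree, so they converge in norm because the total is finite.

    Finally [star] is a topological group law because Anti (x (x) y) is bilinear
    and bounded by |x| |y| in the Hilbert-Schmidt norm; the encoding is a
    homeomorphism onto its image by definition of the transported topology, and
    it carries [star] to the exterior product. *)

(** * The algebra of forms under the shuffle product *)

Section exterior_algebra.
Variables (R : realType) (H : hilbertType R).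
Local Notation form := (seq H -> R).
Implicit Types (u v w : form) (h k x y : H) (s t r : seq H).

(** The interior product of [u] by [h]. A form is determined by its value on
    the empty sequence and by its contractions, so identities between wedge
    products are proved below by induction on the sequence of arguments. *)
Definition contract h u : form := fun s => u (h :: s).

Definition parity u : form := fun s => (-1) ^+ size s * u s.

Lemma contractD h u v : contract h (u + v) = contract h u + contract h v.
Proof. by []. Qed.

Lemma contractZ h a u : contract h (a *: u) = a *: contract h u.
Proof. by []. Qed.

Lemma contract_parity h u : contract h (parity u) = - parity (contract h u).
Proof. by apply/funext => s; rewrite !fctE /contract /parity/= exprS mulN1r mulNr. Qed.

Lemma parityK : involutive parity.
Proof.
by move=> u; apply/funext => s; rewrite /parity mulrA -expr2 sqrr_sign mul1r.
Qed.

Lemma parityD u v : parity (u + v) = parity u + parity v.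
Proof. by apply/funext => s; rewrite /parity !fctE mulrDr. Qed.

Lemma parityZ a u : parity (a *: u) = a *: parity u.
Proof. by apply/funext => s; rewrite /parity !fctE mulrCA. Qed.

Lemma wedge_nil u v : wedge u v [::] = u [::] * v [::].
Proof.
rewrite /wedge (big_pred1 [tuple])/= ?mul1r// => m.
by apply/esym/eqP; exact: tuple0.
Qed.

Lemma sign_size_mask (m : bitseq) s : size m = size s ->
  (-1) ^+ count id m = (-1) ^+ size (mask m s) :> R.
Proof. by move=> ms; rewrite size_mask. Qed.

(** A shuffle of [h :: s] sends [h] either to [u], creating no inversion, or to
    [v], where it is jumped over by all the arguments that go to [u]; the latter
    gives the sign carried by [parity u]. *)
Lemma wedge_cons u v h s :
  wedge u v (h :: s) = wedge (contract h u) v s + wedge (parity u) (contract h v) s.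
Proof.
rewrite /wedge /=.
(* A mask of [h :: s] is the choice made for [h] followed by a mask of [s]. *)
pose f (p : bool * (size s).-tuple bool) := [tuple of p.1 :: p.2].
pose g (m : (size s).+1.-tuple bool) := (thead m, [tuple of behead m]).
have fg : {on [pred _ | true], bijective f}.
  exists g => [[b m] _|m _]; rewrite /f /g/=.
    by congr pair; apply: val_inj.
  by rewrite [RHS]tuple_eta; apply: val_inj.
rewrite (reindex f fg)/=.
rewrite -(pair_big xpredT xpredT (fun b (m : (size s).-tuple bool) =>
  (-1) ^+ inversions (f (b, m)) * u (mask (f (b, m)) (h :: s)) *
     v (mask (map negb (f (b, m))) (h :: s))))/=.
rewrite big_bool/=; congr (_ + _); apply: eq_bigr => m _.
rewrite /parity /contract exprD !mulrA; congr (_ * _ * _).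
by rewrite (@sign_size_mask _ s) ?size_tuple// mulrC.
Qed.

(** Contractions are antiderivations of the exterior product. *)
Lemma contract_wedge h u v : contract h (wedge u v) =
  wedge (contract h u) v + wedge (parity u) (contract h v).
Proof. by apply/funext => s; rewrite /contract wedge_cons. Qed.

Lemma wedgeDl u v w : wedge (u + v) w = wedge u w + wedge v w.
Proof.
apply/funext => s; rewrite !fctE /wedge -big_split/=; apply: eq_bigr => m _.
by rewrite mulrDr mulrDl.
Qed.

Lemma wedgeDr u v w : wedge u (v + w) = wedge u v + wedge u w.
Proof.
apply/funext => s; rewrite !fctE /wedge -big_split/=; apply: eq_bigr => m _.
by rewrite mulrDr.
Qed.

Lemma wedgeZl a u v : wedge (a *: u) v = a *: wedge u v.
Proof.
apply/funext => s; rewrite !fctE /wedge scaler_sumr; apply: eq_bigr => m _.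
by rewrite /GRing.scale/=; ring.
Qed.

Lemma wedgeZr a u v : wedge u (a *: v) = a *: wedge u v.
Proof.
apply/funext => s; rewrite !fctE /wedge scaler_sumr; apply: eq_bigr => m _.
by rewrite /GRing.scale/=; ring.
Qed.

Lemma wedgeNl u v : wedge (- u) v = - wedge u v.
Proof. by rewrite -(scaleN1r u) wedgeZl scaleN1r. Qed.

Lemma wedgeNr u v : wedge u (- v) = - wedge u v.
Proof. by rewrite -(scaleN1r v) wedgeZr scaleN1r. Qed.

Lemma wedge0l u : wedge 0 u = 0.
Proof. by rewrite -(scale0r 0) wedgeZl !scale0r. Qed.

Lemma wedge0r u : wedge u 0 = 0.
Proof. by rewrite -(scale0r 0) wedgeZr !scale0r. Qed.

Lemma contract_form1 h : contract h (form1 (R:=R) (H:=H)) = 0.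
Proof. exact/funext. Qed.

Lemma wedge1l u : wedge (form1 (H:=H)) u = u.
Proof.
apply/funext => s; elim: s u => [|h s IH] u; first by rewrite wedge_nil mul1r.
have p1 : parity (form1 (H:=H)) = form1 (H:=H).
  by apply/funext => -[|k r]; rewrite /parity /= ?mulr0// mul1r.
by rewrite wedge_cons contract_form1 p1 wedge0l add0r IH.
Qed.

Lemma wedge1r u : wedge u (form1 (H:=H)) = u.
Proof.
apply/funext => s; elim: s u => [|h s IH] u; first by rewrite wedge_nil mulr1.
by rewrite wedge_cons contract_form1 wedge0r addr0 IH.
Qed.

Lemma parity_wedge u v : parity (wedge u v) = wedge (parity u) (parity v).
Proof.
apply/funext => s; elim: s u v => [|h s IH] u v.
  by rewrite /parity/= !wedge_nil/= !mul1r.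
rewrite wedge_cons !contract_parity wedgeNl wedgeNr !fctE -!IH.
by rewrite /parity /= wedge_cons exprS mulN1r !mulNr -opprD -mulrDr.
Qed.

(** Both sides satisfy the same recursion once [parity] is seen to be
    multiplicative. *)
Lemma wedgeA u v w : wedge u (wedge v w) = wedge (wedge u v) w.
Proof.
apply/funext => s; elim: s u v w => [|h s IH] u v w.
  by rewrite !wedge_nil mulrA.
rewrite !wedge_cons !contract_wedge wedgeDl wedgeDr !fctE !IH.
by rewrite parity_wedge addrA.
Qed.

(** Graded commutativity holds for all forms, alternating or not, because it
    only concerns the sign of the block transposition. The even and odd cases
    need each other, as a contraction reverses the parity of [u]. *)
Lemma wedge_comm_parity s :
  (forall u v, parity u = u -> wedge u v s = wedge v u s) /\
  (forall u v, parity u = - u -> wedge u v s = wedge (parity v) u s).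
Proof.
elim: s => [|h s [IHe IHo]]; split=> u v up.
- by rewrite !wedge_nil mulrC.
- by rewrite !wedge_nil mulrC /parity mul1r.
- have Du : parity (contract h u) = - contract h u.
    by rewrite -[RHS]opprK opprK -{2}up contract_parity opprK.
  by rewrite !wedge_cons up (IHe u)// (IHo (contract h u))// addrC.
- have Du : parity (contract h u) = contract h u.
    by apply: oppr_inj; rewrite -contract_parity up.
  rewrite !wedge_cons up parityK contract_parity !wedgeNl !fctE.
  by rewrite (IHe (contract h u))// (IHo u)// addrC.
Qed.

Lemma even_wedgeC u v : parity u = u -> wedge u v = wedge v u.
Proof. by move=> up; apply/funext => s; apply (wedge_comm_parity s).1. Qed.

Lemma odd_wedgeC u v : parity u = - u -> wedge u v = wedge (parity v) u.
Proof. by move=> up; apply/funext => s; apply (wedge_comm_parity s).2. Qed.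

Lemma odd_wedge_sq u : parity u = - u -> wedge u u = 0.
Proof.
move=> up; apply/funext => s.
have /(congr1 (fun w => w s)) := odd_wedgeC u up.
rewrite up wedgeNl fctE => uu; rewrite -[RHS]/(0 : R); lra.
Qed.

(** Used to replace an infinite exponential series by one of its partial sums. *)
Lemma wedge_local_r n u v w :
  (forall s, (size s < n)%N -> v s = w s) ->
  forall s, (size s < n)%N -> wedge u v s = wedge u w s.
Proof.
move=> vw s sn; apply: eq_bigr => m _; rewrite vw//.
by rewrite (leq_ltn_trans _ sn)// size_subseq// mask_subseq.
Qed.

Lemma parity_vec x : parity (vec x) = - vec x.
Proof.
by apply/funext => -[|h [|k s]]; rewrite /parity !fctE/= ?mulr0 ?oppr0// mulN1r.
Qed.

Lemma contract_vec h x : contract h (vec x) = dot x h *: form1 (H:=H).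
Proof.
by apply/funext => -[|k s]; rewrite /contract !fctE /GRing.scale/= ?mulr1 ?mulr0.
Qed.

Lemma contract_vec_wedge h x u :
  contract h (wedge (vec x) u) = dot x h *: u - wedge (vec x) (contract h u).
Proof.
by rewrite contract_wedge contract_vec wedgeZl wedge1l parity_vec wedgeNl.
Qed.

Lemma vec_sq x : wedge (vec x) (vec x) = 0.
Proof. by apply: odd_wedge_sq; exact: parity_vec. Qed.

Lemma vec_antiC x y : wedge (vec x) (vec y) = - wedge (vec y) (vec x).
Proof. by rewrite odd_wedgeC ?parity_vec// wedgeNl. Qed.

Lemma vecD x y : vec (x + y) = vec x + vec y.
Proof.
by apply/funext => -[|h [|k s]]; rewrite !fctE/= ?addr0// dotDl.
Qed.

Lemma vec_wedgeE x y s : wedge (vec x) (vec y) s =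
  if s is [:: h; k] then dot x h * dot y k - dot y h * dot x k else 0.
Proof.
case: s => [|h s]; first by rewrite wedge_nil mul0r.
rewrite -[LHS]/(contract h _ _) contract_vec_wedge contract_vec wedgeZr wedge1r.
rewrite !fctE /GRing.scale/=.
by case: s => [|k [|l s]]//=; rewrite !mulr0 subr0.
Qed.

End exterior_algebra.

(** * Alternating, multilinear, bounded forms *)

Section regular_forms.
Variables (R : realType) (H : hilbertType R).
Local Notation form := (seq H -> R).
Implicit Types (u v w : form) (h k x y : H) (s t r : seq H).

(** Unlike [alternating], this condition on adjacent arguments is visibly
    inherited by contractions and is checked on a product by contracting
    twice. The two are equivalent for multilinear forms. *)
Definition antisymmetric_form u := forall s t x y,
  u (s ++ x :: y :: t) = - u (s ++ y :: x :: t).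

Lemma antisymmetric_contract h u :
  antisymmetric_form u -> antisymmetric_form (contract h u).
Proof. by move=> ua s t x y; exact: (ua (h :: s)). Qed.

Lemma contractC h k u : antisymmetric_form u ->
  contract h (contract k u) = - contract k (contract h u).
Proof. by move=> ua; apply/funext => s; exact: (ua [::]). Qed.

Lemma contract_sq h u : antisymmetric_form u -> contract h (contract h u) = 0.
Proof.
move=> ua; apply/funext => s; have := ua [::] s h h.
rewrite /contract/= => uE; rewrite -[RHS]/(0 : R); lra.
Qed.

Lemma antisymmetric_parity u :
  antisymmetric_form u -> antisymmetric_form (parity u).
Proof.
by move=> ua s t x y; rewrite /parity ua !size_cat/= mulrN.
Qed.

(** Contracting a product twice gives four terms: the two mixed ones are
    exchanged, up to sign, when the two vectors are. *)
Lemma antisymmetric_wedge u v : antisymmetric_form u -> antisymmetric_form v ->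
  antisymmetric_form (wedge u v).
Proof.
move=> ua va s t x y; elim: s u v ua va => [|h s IH] u v ua va; last first.
  rewrite !cat_cons !wedge_cons opprD IH ?IH//; first exact: antisymmetric_parity.
  - exact: antisymmetric_contract.
  - exact: antisymmetric_contract.
rewrite /= !wedge_cons !contract_parity !parityK (contractC x y ua) (contractC x y va).
rewrite !(wedgeNl, wedgeNr) !fctE; ring.
Qed.

(** Move the two equal arguments next to each other, where a real number equal to
    its opposite vanishes. *)
Lemma antisymmetric_alternating u : antisymmetric_form u -> Defs.alternating u.
Proof.
move=> ua s t; elim: t s => [|h t IH] s r x /=.
  by have := ua s r x x; lra.
by rewrite ua -cat_rcons IH oppr0.
Qed.

Lemma alternating_antisymmetric u :
  multilinear u -> Defs.alternating u -> antisymmetric_form u.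
Proof.
move=> um ua s t x y; have := ua s [::] t (x + y); rewrite /=.
have D s' t' x' y' : u (s' ++ (x' + y') :: t') = u (s' ++ x' :: t') + u (s' ++ y' :: t').
  by have := um s' t' 1 x' y'; rewrite scale1r mul1r.
have E x' : u (s ++ x' :: (x + y) :: t) =
    u (s ++ x' :: x :: t) + u (s ++ x' :: y :: t).
  by rewrite -!(cat_rcons x') D.
rewrite D !E !(ua s [::]); lra.
Qed.

Lemma multilinear_contract h u : multilinear u -> multilinear (contract h u).
Proof. by move=> um s t a x y; exact: (um (h :: s)). Qed.

Lemma multilinear_parity u : multilinear u -> multilinear (parity u).
Proof. by move=> um s t a x y; rewrite /parity um !size_cat/=; ring. Qed.

Lemma multilinear_wedge u v :
  multilinear u -> multilinear v -> multilinear (wedge u v).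
Proof.
move=> um vm s t a x y; elim: s u v um vm => [|h s IH] u v um vm; last first.
  rewrite !cat_cons !wedge_cons !IH//; first ring.
  - exact: multilinear_parity.
  - exact: multilinear_contract.
  - exact: multilinear_contract.
have c w : multilinear w ->
    contract (a *: x + y) w = a *: contract x w + contract y w.
  by move=> wm; apply/funext => r; exact: (wm [::]).
rewrite /= !wedge_cons !c// !(wedgeDl, wedgeDr, wedgeZl, wedgeZr) !fctE.
rewrite /GRing.scale/=; ring.
Qed.

Lemma prod_mask (m : bitseq) s : size m = size s ->
  (\prod_(x <- mask m s) `|x|) * (\prod_(x <- mask (map negb m) s) `|x|) =
  \prod_(x <- s) `|x| :> R.
Proof.
elim: s m => [|x s IH] [|[] m]//= => [_|[ms]|[ms]].
- by rewrite !big_nil mulr1.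
- by rewrite !big_cons -mulrA IH.
- by rewrite !big_cons mulrCA IH.
Qed.

Lemma prod_norm_ge0 s : 0 <= \prod_(x <- s) `|x| :> R.
Proof. exact: prodr_ge0. Qed.

(** Each shuffle distributes the norms of the arguments among the two factors
    without changing their product. *)
Lemma bounded_wedge u v :
  bounded_form u -> bounded_form v -> bounded_form (wedge u v).
Proof.
move=> /choice[c uc] /choice[d vd] k.
exists (\sum_(m : k.-tuple bool)
          `|c (count id m)| * `|d (count id (map negb m))|) => s sk.
subst k; rewrite mulr_suml (le_trans (ler_norm_sum _ _ _))//.
apply: ler_sum => m _; rewrite -mulrA normrM normrX normrN1 expr1n mul1r normrM.
rewrite -(@prod_mask m s) ?size_tuple// mulrACA ler_pM//.
  apply: (le_trans (uc (count id m) _ _)).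
    by rewrite size_mask ?size_tuple.
  by rewrite ler_wpM2r ?prod_norm_ge0 ?ler_norm.
apply: (le_trans (vd (count id (map negb m)) _ _)).
  by rewrite size_mask ?size_map ?size_tuple.
by rewrite ler_wpM2r ?prod_norm_ge0 ?ler_norm.
Qed.

Definition regular_form u := [/\ multilinear u, Defs.alternating u & bounded_form u].

Lemma regular_antisymmetric u : regular_form u -> antisymmetric_form u.
Proof. by case=> um ua _; exact: alternating_antisymmetric. Qed.

Lemma regular_wedge u v :
  regular_form u -> regular_form v -> regular_form (wedge u v).
Proof.
move=> ur vr; have [um _ ub] := ur; have [vm _ vb] := vr; split.
- exact: multilinear_wedge.
- apply: antisymmetric_alternating.
  by apply: antisymmetric_wedge; exact: regular_antisymmetric.
- exact: bounded_wedge.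
Qed.

Lemma regularD u v : regular_form u -> regular_form v -> regular_form (u + v).
Proof.
move=> [um ua ub] [vm va vb]; split.
- by move=> s t a x y; rewrite !fctE um vm; ring.
- by move=> s t r x; rewrite !fctE ua va addr0.
- move=> k; have [C uC] := ub k; have [D vD] := vb k; exists (C + D) => s sk.
  by rewrite !fctE mulrDl (le_trans (ler_normD _ _))// lerD ?uC ?vD.
Qed.

Lemma regularZ a u : regular_form u -> regular_form (a *: u).
Proof.
move=> [um ua ub]; split.
- by move=> s t b x y; rewrite !fctE um /GRing.scale/=; ring.
- by move=> s t r x; rewrite !fctE ua scaler0.
- move=> k; have [C uC] := ub k; exists (`|a| * C) => s sk.
  by rewrite !fctE normrM -mulrA ler_wpM2l ?uC.
Qed.

Lemma regular_form1 : regular_form (form1 (H:=H)).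
Proof.
split=> [[|? ?] ? ? ? ?|[|? ?] ? ? ?|k] //=; rewrite ?mulr0 ?addr0//.
exists 1 => -[|? ?] _ /=; first by rewrite normr1 big_nil mulr1.
by rewrite normr0 mul1r prod_norm_ge0.
Qed.

(** The three conditions only compare values on sequences of one fixed size; this
    transfers them from the partial sums of an exponential to its limit. *)
Lemma regular_degreewise u :
  (forall n, exists2 v, regular_form v & forall s, size s = n -> u s = v s) ->
  regular_form u.
Proof.
move=> deg; split.
- move=> s t a x y; have [v [vm _ _] uv] := deg (size s + (size t).+1)%N.
  by rewrite !uv ?size_cat.
- move=> s t r x; have [v [_ va _] uv] := deg (size (s ++ x :: t ++ x :: r)).
  by rewrite uv.
- move=> k; have [v [_ _ vb] uv] := deg k; have [C vC] := vb k; exists C => s sk.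
  by rewrite uv ?vC.
Qed.

End regular_forms.

(** * The exterior exponential *)

Section exponential.
Variables (R : realType) (H : hilbertType R).
Local Notation form := (seq H -> R).
Implicit Types (u v w b c : form) (h k x y : H) (s t r : seq H).

(** The degrees of the nonzero homogeneous components of [u] satisfy [P]. *)
Definition supported (P : pred nat) u := forall s, ~~ P (size s) -> u s = 0.

Lemma supported_wedge (P Q W : pred nat) u v :
  (forall i j, P i -> Q j -> W (i + j)%N) ->
  supported P u -> supported Q v -> supported W (wedge u v).
Proof.
move=> PQW uP vQ s sW; rewrite /wedge big1// => m _.
have sE : size s = (size (mask m s) + size (mask (map negb m) s))%N.
  rewrite !size_mask ?size_map ?size_tuple// count_map.
  by rewrite -[LHS](size_tuple m) -(count_predC id m).
have [Pm|Pm] := boolP (P (size (mask m s))); last by rewrite uP// mulr0 mul0r.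
have [Qm|Qm] := boolP (Q (size (mask (map negb m) s))); last by rewrite vQ// mulr0.
by case/negP: sW; have := PQW _ _ Pm Qm; rewrite -sE.
Qed.

Lemma supportedD (P : pred nat) u v :
  supported P u -> supported P v -> supported P (u + v).
Proof. by move=> uP vP s sP; rewrite !fctE uP ?vP ?addr0. Qed.

Lemma supportedZ (P : pred nat) a u : supported P u -> supported P (a *: u).
Proof. by move=> uP s sP; rewrite !fctE uP ?scaler0. Qed.

Lemma supportedW (P Q : pred nat) u :
  (forall n, P n -> Q n) -> supported P u -> supported Q u.
Proof. by move=> PQ uP s sQ; rewrite uP//; apply: contra sQ; exact: PQ. Qed.

Lemma supported_form1 : supported (pred1 0%N) (form1 (H:=H)).
Proof. by case. Qed.

Lemma supported_vec x : supported (pred1 1%N) (vec x).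
Proof. by move=> [|? [|? ?]]. Qed.

Lemma wpowS u n : wpow u n.+1 = wedge u (wpow u n).
Proof. by []. Qed.

Lemma wpow1 u : wpow u 1 = u.
Proof. exact: wedge1r. Qed.

Lemma supported_wpow u n : u [::] = 0 ->
  supported (leq n) (wpow u n).
Proof.
move=> u0; elim: n => [|n IH]; first by move=> s.
apply: (@supported_wedge (leq 1) _ _ _ _ _ _ IH) => [i j|].
  by rewrite -add1n; exact: leq_add.
by case.
Qed.

Lemma supported_wpow2 b n : supported (pred1 2%N) b ->
  supported (pred1 (2 * n)%N) (wpow b n).
Proof.
move=> b2; elim: n => [|n IH]; first exact: supported_form1.
by apply: supported_wedge b2 IH => i j /eqP -> /eqP ->; rewrite /= mulnS.
Qed.

Lemma supported2_even b : supported (pred1 2%N) b -> parity b = b.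
Proof.
move=> b2; apply/funext => s; rewrite /parity.
case: (eqVneq (size s) 2%N) => [->|/b2 ->]; last by rewrite mulr0.
by rewrite sqrrN expr1n mul1r.
Qed.

Lemma even_wpow b n : parity b = b -> parity (wpow b n) = wpow b n.
Proof.
move=> be; elim: n => [|n IH]; last by rewrite parity_wedge be IH.
by apply/funext => -[|? ?]; rewrite /parity/= ?mulr0 ?mul1r.
Qed.

(** On even forms contractions are true derivations and everything commutes,
    whence the usual rule for the derivative of a power. *)
Lemma contract_wpow h b n : parity b = b ->
  contract h (wpow b n.+1) = n.+1%:R *: wedge (contract h b) (wpow b n).
Proof.
move=> be; elim: n => [|n IH]; first by rewrite wpow1 scale1r wedge1r.
rewrite wpowS contract_wedge be IH wedgeZr.
rewrite (wedgeA b (contract h b)) (even_wedgeC _ be) -(wedgeA (contract h b)).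
by rewrite -wpowS -[in RHS]natr1 scalerDl scale1r addrC.
Qed.

(** Binomial formula for the commuting forms [vec x] and [b], cut after the second
    term since [vec x] squares to zero. *)
Lemma wpow_vecD x b n : parity b = b ->
  wpow (vec x + b) n.+1 = wpow b n.+1 + n.+1%:R *: wedge (vec x) (wpow b n).
Proof.
move=> be; elim: n => [|n IH]; first by rewrite !wpow1 scale1r wedge1r addrC.
rewrite wpowS IH wedgeDl !wedgeDr !wedgeZr (wedgeA (vec x) (vec x)) vec_sq.
rewrite wedge0l scaler0 addr0 (wedgeA b (vec x)) (even_wedgeC (vec x) be).
rewrite -(wedgeA (vec x) b) -!wpowS.
by rewrite addrCA -[in RHS]natr1 scalerDl scale1r; congr (_ + _); rewrite addrC.
Qed.

(** The n-th power has no component of degree less than [n]. *)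
Lemma wexpE u s N : u [::] = 0 -> (size s < N)%N ->
  wexp u s = \sum_(n < N) (n`!%:R)^-1 * wpow u n s.
Proof.
move=> u0 sN; apply: (@lim_near_cst R^o) => //.
near=> n; rewrite /series/= -(big_mkord xpredT (fun n => (n`!%:R)^-1 * wpow u n s)).
rewrite (@big_cat_nat _ _ _ N)//=; last by near: n; exact: nbhs_infty_ge.
rewrite [X in _ + X]big_nat_cond [X in _ + X]big1 ?addr0// => i /andP[/andP[Ni _] _].
rewrite /exp_terms !fctE (@supported_wpow u i u0)/= ?scaler0//.
by rewrite -ltnNge (leq_trans sN).
Unshelve. all: by end_near.
Qed.

Lemma wexp_nil u : u [::] = 0 -> wexp u [::] = 1.
Proof. by move=> u0; rewrite (@wexpE _ _ 1)// big_ord1/= invr1 mul1r. Qed.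

Lemma even_wexp b : parity b = b -> b [::] = 0 -> parity (wexp b) = wexp b.
Proof.
move=> be b0; apply/funext => s; rewrite /parity (@wexpE _ _ (size s).+1)//.
rewrite mulr_sumr; apply: eq_bigr => n _.
by rewrite mulrCA -[(-1) ^+ _ * _]/(parity (wpow b n) s) even_wpow.
Qed.

Lemma wedge_wexp u b s N : b [::] = 0 -> (size s < N)%N ->
  wedge u (wexp b) s = \sum_(n < N) (n`!%:R)^-1 * wedge u (wpow b n) s.
Proof.
move=> b0 sN.
pose T : form := \sum_(n < N) ((n`!%:R)^-1 : R) *: wpow b n.
have TE r : T r = \sum_(n < N) (n`!%:R)^-1 * wpow b n r by rewrite /T fct_sumE.
rewrite (@wedge_local_r _ _ N u (wexp b) T)//; last first.
  by move=> r rN; rewrite TE (wexpE b0 rN).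
have -> : wedge u T = \sum_(n < N) ((n`!%:R)^-1 : R) *: wedge u (wpow b n).
  rewrite /T (big_morph (wedge u) (wedgeDr u) (wedge0r u)).
  by apply: eq_bigr => n _; rewrite wedgeZr.
by rewrite fct_sumE.
Qed.

(** The differential equation of the exponential; with [contract_unique] it
    characterizes [wexp b] and yields the functional equations below. *)
Lemma contract_wexp h b : parity b = b -> b [::] = 0 ->
  contract h (wexp b) = wedge (contract h b) (wexp b).
Proof.
move=> be b0; apply/funext => s.
rewrite (@wedge_wexp _ _ _ (size s).+1)// /contract (@wexpE _ _ (size s).+2)//.
rewrite big_ord_recl/= [X in _ * X + _](_ : _ = 0)// mulr0 add0r; apply: eq_bigr => n _.
rewrite -[X in _ * X]/(contract h (wpow b n.+1) s) contract_wpow// !fctE.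
rewrite /GRing.scale/= mulrA factS natrM invfM; congr (_ * _).
by rewrite mulrAC mulVf ?mul1r// pnatr_eq0.
Qed.

(** The equation expresses the values on sequences of size [n.+1] by the values on
    sequences of size at most [n]. *)
Lemma contract_unique (w : H -> form) u v :
  (forall h, contract h u = wedge (w h) u) ->
  (forall h, contract h v = wedge (w h) v) -> u [::] = v [::] -> u = v.
Proof.
move=> uE vE uv0; apply/funext => s.
have [n sn] : exists n, (size s < n)%N by exists (size s).+1.
elim: n s sn => // n IH [|h s] // sn.
rewrite -[LHS]/(contract h u s) -[RHS]/(contract h v s) uE vE.
exact: wedge_local_r IH _ sn.
Qed.

Lemma wexpD b c : parity b = b -> b [::] = 0 -> parity c = c -> c [::] = 0 ->
  wexp (b + c) = wedge (wexp b) (wexp c).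
Proof.
move=> be b0 ce c0; have bc0 : (b + c) [::] = 0 by rewrite fctE b0 c0 addr0.
apply: (@contract_unique (fun h => contract h (b + c))).
- by move=> h; rewrite contract_wexp// parityD be ce.
- move=> h; rewrite contract_wedge !contract_wexp// even_wexp// contractD.
  rewrite wedgeDl !wedgeA; congr (_ + wedge _ _).
  by rewrite even_wedgeC// even_wexp.
- by rewrite wedge_nil !wexp_nil// mulr1.
Qed.

(** The series stops at the linear term because [vec x] and [vec y] square to
    zero. *)
Lemma wexp_vec_wedge x y :
  wexp (wedge (vec x) (vec y)) = form1 (H:=H) + wedge (vec x) (vec y).
Proof.
have e : parity (wedge (vec x) (vec y)) = wedge (vec x) (vec y).
  by rewrite parity_wedge !parity_vec wedgeNl wedgeNr opprK.
have z : wedge (vec x) (vec y) [::] = 0 by rewrite wedge_nil mul0r.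
apply: (@contract_unique (fun h => contract h (wedge (vec x) (vec y)))).
- by move=> h; exact: contract_wexp.
- move=> h; rewrite contractD wedgeDr wedge1r contract_form1 add0r.
  rewrite contract_vec_wedge contract_vec wedgeZr wedge1r.
  rewrite wedgeDl wedgeNl !wedgeZl (wedgeA (vec x) (vec x)) vec_sq wedge0l.
  rewrite (vec_antiC x y) wedgeNr wedgeA vec_sq wedge0l !(scaler0, oppr0).
  by rewrite !addr0.
- by rewrite fctE z addr0 wexp_nil.
Qed.

Lemma wexp_vecD x b : parity b = b -> b [::] = 0 ->
  wexp (vec x + b) = wexp b + wedge (vec x) (wexp b).
Proof.
move=> be b0; apply/funext => s; have u0 : (vec x + b) [::] = 0.
  by rewrite fctE b0 addr0.
rewrite -[RHS]/(wexp b s + wedge (vec x) (wexp b) s) (@wedge_wexp _ _ _ (size s).+1)//.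
rewrite (@wexpE b _ (size s).+2)// (@wexpE _ _ (size s).+2)//.
rewrite big_ord_recl [in RHS]big_ord_recl/= -addrA -big_split/=; congr (_ + _).
apply: eq_bigr => n _; rewrite -!wpowS wpow_vecD// !fctE mulrDr; congr (_ + _).
rewrite /GRing.scale/= mulrA factS natrM invfM; congr (_ * _).
by rewrite mulrAC mulVf ?mul1r// pnatr_eq0.
Qed.

(** With the even exponentials pulled out, what remains is the identity
    (1 + x + y) (1 + x y) = (1 + x) (1 + y), where x x y and y x y vanish. *)
Lemma wexp_vecD_mul x y b c :
  parity b = b -> b [::] = 0 -> parity c = c -> c [::] = 0 ->
  wexp (vec (x + y) + (b + c + wedge (vec x) (vec y))) =
  wedge (wexp (vec x + b)) (wexp (vec y + c)).
Proof.
move=> be b0 ce c0.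
have e : parity (wedge (vec x) (vec y)) = wedge (vec x) (vec y).
  by rewrite parity_wedge !parity_vec wedgeNl wedgeNr opprK.
have z : wedge (vec x) (vec y) [::] = 0 by rewrite wedge_nil mul0r.
have bce : parity (b + c) = b + c by rewrite parityD be ce.
have bc0 : (b + c) [::] = 0 by rewrite fctE b0 c0 addr0.
rewrite !wexp_vecD//; last 2 first.
- by rewrite parityD bce e.
- by rewrite fctE bc0 z addr0.
rewrite wexpD// wexpD// wexp_vec_wedge vecD.
set B := wexp b; set C := wexp c.
have BE : parity B = B by exact: even_wexp.
have CE : parity C = C by exact: even_wexp.
have BC : parity (wedge B C) = wedge B C by rewrite parity_wedge BE CE.
set X := vec x; set Y := vec y; set I : form := form1 (H:=H).
have split1 u v : v + wedge u v = wedge (I + u) v by rewrite wedgeDl wedge1l.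
(* Both sides become a polynomial in X and Y times [wedge B C]. *)
rewrite !split1 (even_wedgeC _ BC) -[RHS]wedgeA (wedgeA B (I + Y)).
rewrite (even_wedgeC (I + Y) BE) -(wedgeA (I + Y) B) !(wedgeA (I + _) (I + _)).
congr wedge.
rewrite !(wedgeDl, wedgeDr) !wedge1l !wedge1r !wedgeA vec_sq wedge0l addr0.
rewrite -(wedgeA Y X) -/Y (vec_antiC x y) wedgeNr wedgeA vec_sq wedge0l oppr0 addr0.
by apply/funext => s; rewrite !fctE; ring.
Qed.

Lemma regular_wpow u n : regular_form u -> regular_form (wpow u n).
Proof.
move=> ur; elim: n => [|n IH]; first exact: regular_form1.
exact: regular_wedge.
Qed.

Lemma regular_wexp u : regular_form u -> u [::] = 0 -> regular_form (wexp u).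
Proof.
move=> ur u0; apply: regular_degreewise => n.
exists (\sum_(k < n.+1) ((k`!%:R)^-1 : R) *: wpow u k).
  elim/big_ind: _ => [|? ? ? ?|k _]; last by apply: regularZ; exact: regular_wpow.
    by rewrite -(scale0r (form1 (H:=H))); apply: regularZ; exact: regular_form1.
  exact: regularD.
by move=> s sn; rewrite (@wexpE _ _ n.+1) ?sn// fct_sumE.
Qed.

End exponential.

(** * Sums of squared coordinates over a finite family of vectors *)

Section finite_fock_product.
Variables (R : realType) (H : hilbertType R).
Local Notation form := (seq H -> R).
Implicit Types (u v w b : form) (h k x y : H) (s t r L : seq H).

(** The sum over all sublists [s] of [L] of [u s * v s]. For an orthonormal list
    this is the inner product of the exterior algebra of its span; this
    recursive form needs no orthonormality and follows contractions. *)
Fixpoint sublist_dot L u v : R :=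
  if L is h :: L' then
    sublist_dot L' u v + sublist_dot L' (contract h u) (contract h v)
  else u [::] * v [::].

Lemma sublist_dotC L u v : sublist_dot L u v = sublist_dot L v u.
Proof.
by elim: L u v => [|h L IH] u v /=; [rewrite mulrC|rewrite IH (IH (contract h u))].
Qed.

Lemma sublist_dotDl L u v w :
  sublist_dot L (u + v) w = sublist_dot L u w + sublist_dot L v w.
Proof.
elim: L u v w => [|h L IH] u v w /=; first by rewrite fctE mulrDl.
by rewrite contractD !IH; ring.
Qed.

Lemma sublist_dotDr L u v w :
  sublist_dot L w (u + v) = sublist_dot L w u + sublist_dot L w v.
Proof. by rewrite sublist_dotC sublist_dotDl !(sublist_dotC _ w). Qed.

Lemma sublist_dotZl L a u v : sublist_dot L (a *: u) v = a * sublist_dot L u v.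
Proof.
elim: L u v => [|h L IH] u v /=; first by rewrite fctE /GRing.scale/= mulrA.
by rewrite contractZ !IH; ring.
Qed.

Lemma sublist_dotZr L a u v : sublist_dot L u (a *: v) = a * sublist_dot L u v.
Proof. by rewrite sublist_dotC sublist_dotZl sublist_dotC. Qed.

Lemma sublist_dotNl L u v : sublist_dot L (- u) v = - sublist_dot L u v.
Proof. by rewrite -(scaleN1r u) sublist_dotZl mulN1r. Qed.

Lemma sublist_dotNr L u v : sublist_dot L u (- v) = - sublist_dot L u v.
Proof. by rewrite sublist_dotC sublist_dotNl sublist_dotC. Qed.

Lemma sublist_dot_ge0 L u : 0 <= sublist_dot L u u.
Proof.
elim: L u => [|h L IH] u /=; first by rewrite -expr2 sqr_ge0.
by rewrite addr_ge0.
Qed.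

(** The sign change [parity] is an isometry, so its eigenspaces are orthogonal. *)
Lemma sublist_dot_even_odd L u v :
  parity u = u -> parity v = - v -> sublist_dot L u v = 0.
Proof.
have parity_dot w z : sublist_dot L (parity w) (parity z) = sublist_dot L w z.
  elim: L w z => [|h L IH] w z /=; first by rewrite /parity !mul1r.
  by rewrite !contract_parity sublist_dotNl sublist_dotNr opprK !IH.
by move=> ue vo; have := parity_dot u v; rewrite ue vo sublist_dotNr; lra.
Qed.

(** The adjoint of the creation operator [wedge (vec x)]. For an orthonormal [L] it
    is annihilation by the projection of [x] on the span of [L]. *)
Definition interior L x u : form := \sum_(h <- L) dot x h *: contract h u.

Lemma interior_nil x u : interior [::] x u = 0.
Proof. exact: big_nil. Qed.

Lemma interior_cons h L x u :
  interior (h :: L) x u = dot x h *: contract h u + interior L x u.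
Proof. exact: big_cons. Qed.

Lemma contract_interior h L x u : antisymmetric_form u ->
  contract h (interior L x u) = - interior L x (contract h u).
Proof.
move=> ua; elim: L => [|k L IH]; first by rewrite !interior_nil oppr0.
rewrite !interior_cons contractD IH opprD contractZ contractC//.
by rewrite scalerN.
Qed.

Lemma sublist_dot_adj L x u v : antisymmetric_form v ->
  sublist_dot L (wedge (vec x) u) v = sublist_dot L u (interior L x v).
Proof.
elim: L u v => [|h L IH] u v va /=.
  by rewrite wedge_nil interior_nil !mul0r -[X in _ * X]/(0 : R) mulr0.
have Dva := antisymmetric_contract h va.
rewrite contract_vec_wedge interior_cons contractD contractZ contract_sq//.
rewrite scaler0 add0r contract_interior//.
rewrite !(sublist_dotDl, sublist_dotDr, sublist_dotNl, sublist_dotNr).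
rewrite !(sublist_dotZl, sublist_dotZr) !IH//; ring.
Qed.

Lemma interior_vec_wedge L x u :
  interior L x (wedge (vec x) u) =
  (\sum_(h <- L) dot x h ^+ 2) *: u - wedge (vec x) (interior L x u).
Proof.
elim: L => [|h L IH]; first by rewrite !interior_nil big_nil scale0r wedge0r subr0.
rewrite !interior_cons IH big_cons contract_vec_wedge wedgeDr wedgeZr.
by rewrite scalerBr scalerDl scalerA -expr2 opprD addrACA.
Qed.

Lemma antisymmetric_vec x : antisymmetric_form (vec x).
Proof. by move=> [|h [|k s]] [|l t] y z /=; rewrite oppr0. Qed.

(** The canonical anticommutation relation [interior_vec_wedge] and adjointness
    give |x /\ u|^2 = |x|^2 |u|^2 - |interior x u|^2. *)
Lemma sublist_dot_vec_wedge_le L x u : antisymmetric_form u ->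
  sublist_dot L (wedge (vec x) u) (wedge (vec x) u) <=
  (\sum_(h <- L) dot x h ^+ 2) * sublist_dot L u u.
Proof.
move=> ua; rewrite sublist_dot_adj; last first.
  by apply: antisymmetric_wedge => //; exact: antisymmetric_vec.
rewrite interior_vec_wedge sublist_dotDr sublist_dotZr sublist_dotNr.
rewrite (sublist_dotC _ u (wedge _ _)) sublist_dot_adj// gerDl oppr_le0.
exact: sublist_dot_ge0.
Qed.

Lemma sublist_dot_vec L x :
  sublist_dot L (vec x) (vec x) = \sum_(h <- L) dot x h ^+ 2.
Proof.
elim: L => [|h L IH]/=; first by rewrite big_nil mul0r.
rewrite big_cons IH contract_vec sublist_dotZl sublist_dotZr addrC mulrA -expr2.
suff -> : sublist_dot L (form1 (H:=H)) (form1 (H:=H)) = 1 by rewrite mulr1.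
elim: L {IH} => [|k L IH] /=; first by rewrite mulr1.
by rewrite IH contract_form1 -(scale0r (0 : form)) sublist_dotZl mul0r addr0.
Qed.

(** Adding one vector [h] to [L] turns the squared norm of G = [wexp b] into
    |G|^2 + |w h /\ G|^2, at most (1 + |w h|^2) |G|^2, while it adds exactly
    |w h|^2 to the squared norm of [b]; conclude with 1 + t <= exp t. *)
Lemma sublist_dot_wexp_le L b (w : H -> H) :
  parity b = b -> b [::] = 0 -> antisymmetric_form (wexp b) ->
  (forall h, contract h b = vec (w h)) ->
  sublist_dot L (wexp b) (wexp b) <= expR (sublist_dot L b b).
Proof.
move=> be b0 Ga bw; elim: L => [|h L IH] /=.
  by rewrite wexp_nil// b0 mulr0 expR0 mulr1.
rewrite contract_wexp// bw expRD mulrC.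
have := sublist_dot_vec_wedge_le L (w h) Ga.
rewrite -sublist_dot_vec => /(lerD (lexx (sublist_dot L (wexp b) (wexp b)))).
move/le_trans; apply; rewrite -[X in X + _]mul1r -mulrDl.
apply: ler_pM => //; first by rewrite addr_ge0 ?sublist_dot_ge0.
  exact: sublist_dot_ge0.
exact: expR_ge1Dx.
Qed.

End finite_fock_product.

(** * The Fock norm as a supremum over finite families *)

Section fock_norm.
Variables (R : realType) (H : hilbertType R).
Local Notation form := (seq H -> R).
Implicit Types (u v w b : form) (h k x y : H) (s t r L : seq H).

Fixpoint sublists (T : Type) (l : seq T) : seq (seq T) :=
  if l is a :: l' then sublists l' ++ [seq a :: i | i <- sublists l'] else [:: [::]].

Lemma mem_sublists (T : eqType) (l i : seq T) : (i \in sublists l) = subseq i l.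
Proof.
elim: l i => [|a l IH] [|b i]//=; rewrite mem_cat IH.
  by rewrite sub0seq.
have [<-|ba] := eqVneq b a.
  rewrite mem_map ?IH => [|? ? []//].
  apply/orP/idP => [[|//]|]; last by right.
  by apply: subseq_trans; exact: subseq_cons.
rewrite [X in _ || X](_ : _ = false) ?orbF//; apply/mapP => -[j _ [ab _]].
by rewrite ab eqxx in ba.
Qed.

Lemma uniq_sublists (T : eqType) (l : seq T) : uniq l -> uniq (sublists l).
Proof.
elim: l => //= a l IH /andP[al /IH ul].
rewrite cat_uniq ul map_inj_uniq => [|? ? []//]; rewrite ul andbT/=.
apply/hasPn => _ /mapP[i _ ->]; rewrite /= mem_sublists.
apply: contra al => /mem_subseq; apply; exact: mem_head.
Qed.

Lemma sublist_dotE (T : Type) (f : T -> H) (l : seq T) u v :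
  sublist_dot (map f l) u v =
  \sum_(i <- sublists l) u (map f i) * v (map f i).
Proof.
elim: l u v => [|a l IH] u v /=; first by rewrite big_seq1.
by rewrite big_cat big_map !IH.
Qed.

Lemma sublist_dot_cat L L' u :
  sublist_dot L u u <= sublist_dot (L ++ L') u u.
Proof.
elim: L u => [|h L IH] u /=; last by rewrite lerD.
elim: L' u => [|h L' IH] u //=; apply: (le_trans (IH u)).
by rewrite lerDl sublist_dot_ge0.
Qed.

Lemma sublist_dot_disjoint L u v :
  (forall s, u s * v s = 0) -> sublist_dot L u v = 0.
Proof.
elim: L u v => [|h L IH] u v uv /=; first exact: uv.
by rewrite IH// IH ?addr0// => s; exact: uv.
Qed.

Lemma sublist_dot_local L u v :
  (forall s, (size s <= size L)%N -> u s = v s) ->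
  sublist_dot L u u = sublist_dot L v v.
Proof.
elim: L u v => [|h L IH] u v uv /=; first by rewrite uv.
congr (_ + _); apply: IH => s sL; first by rewrite uv// (leq_trans sL).
by rewrite /contract uv.
Qed.

Definition prefix_dot e n u v := sublist_dot [seq e i | i <- iota 0 n] u v.

Lemma prefix_dot_le (e : nat -> H) m n u : (m <= n)%N ->
  prefix_dot e m u u <= prefix_dot e n u u.
Proof.
move=> mn; rewrite /prefix_dot -(subnKC mn) iotaD map_cat.
exact: sublist_dot_cat.
Qed.

Lemma sorted_sublists (i : seq nat) n : sorted ltn i ->
  (forall j, j \in i -> (j < n)%N) -> i \in sublists (iota 0 n).
Proof.
move=> si ilt; rewrite mem_sublists.
have -> : i = [seq j <- iota 0 n | j \in i].
  apply: (irr_sorted_eq ltn_trans ltnn si).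
    by apply: sorted_filter (iota_ltn_sorted _ _); exact: ltn_trans.
  move=> j; rewrite mem_filter mem_iota/= add0n; case: (boolP (j \in i)) => //= /ilt.
  by move=> ->.
exact: filter_subseq.
Qed.

(** The sublists of the prefixes of the basis exhaust the increasing families of
    indices, and every finite set of these occurs in one prefix. *)
Lemma fock_sqnormE e u :
  fock_sqnorm e u = ereal_sup (range (fun n => (prefix_dot e n u u)%:E)).
Proof.
have prefixE n : ((prefix_dot e n u u)%:E =
    \sum_(i \in [set` sublists (iota 0 n)]) ((u [seq e j | j <- i]) ^+ 2)%:E)%E.
  rewrite -fsbig_seq ?uniq_sublists ?iota_uniq// /prefix_dot sublist_dotE.
  by rewrite -sumEFin; apply: eq_bigr => i _; rewrite expr2.
apply/eqP; rewrite eq_le; apply/andP; split.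
- apply: ge_ereal_sup => _ [A [Afin AS] <-].
  have [n An] : exists n, forall i j, A i -> j \in i -> (j < n)%N.
    have /finite_seqP[r rA] := Afin.
    (* Any bound on all the indices that occur will do. *)
    exists (\sum_(i <- r) \sum_(j <- i) j.+1)%N => i j; rewrite rA/= => ir ji.
    rewrite (big_rem i)//=.
    by rewrite (big_rem j)//= -!addnA leq_addr.
  apply: (@le_trans _ _ (prefix_dot e n u u)%:E); last first.
    by apply: ereal_sup_ubound; exists n.
  rewrite prefixE; apply: lee_fsum_nneg_subset => // [|i|i _].
    exact: finite_seq.
    rewrite !inE => Ai; apply: sorted_sublists; first exact: AS.
    by move=> j; exact: An.
  by rewrite lee_fin sqr_ge0.
- apply: ge_ereal_sup => _ [n _ <-]; apply: esum_ge.
  exists [set` sublists (iota 0 n)]; last by rewrite prefixE.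
  split; first exact: finite_seq.
  move=> i /=; rewrite mem_sublists => /subseq_sorted; apply.
    exact: ltn_trans.
  exact: iota_ltn_sorted.
Qed.

Lemma prefix_dot_le_sqnorm e n u : ((prefix_dot e n u u)%:E <= fock_sqnorm e u)%E.
Proof. by rewrite fock_sqnormE; apply: ereal_sup_ubound; exists n. Qed.

Lemma fock_sqnorm_le e u c :
  (forall n, ((prefix_dot e n u u)%:E <= c)%E) -> (fock_sqnorm e u <= c)%E.
Proof. by move=> uc; rewrite fock_sqnormE; apply: ge_ereal_sup => _ [n _ <-]. Qed.

Lemma fock_sqnorm_ge0 e u : (0 <= fock_sqnorm e u)%E.
Proof.
by apply: le_trans (prefix_dot_le_sqnorm e 0 u); rewrite lee_fin sublist_dot_ge0.
Qed.

Definition degree_ge n u : form := fun s => if (size s < n)%N then 0 else u s.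

(** The components of degree at least [n] and the sublists of length at most [m]
    contribute disjoint terms to the squared norm of [u]. *)
Lemma prefix_dot_degree_ge e m n M u : (m < n)%N ->
  prefix_dot e M (degree_ge n u) (degree_ge n u) + prefix_dot e m u u <=
  prefix_dot e (maxn m M) u u.
Proof.
move=> mn; pose low : form := fun s => if (size s < n)%N then u s else 0.
have uE : u = degree_ge n u + low.
  by apply/funext => s; rewrite !fctE /degree_ge /low; case: ifP; rewrite ?add0r ?addr0.
have d0 s : degree_ge n u s * low s = 0.
  by rewrite /degree_ge /low; case: ifP; rewrite ?mul0r ?mulr0.
have -> : prefix_dot e m u u = prefix_dot e m low low.
  apply: sublist_dot_local => s; rewrite size_map size_iota => sm.
  by rewrite /low (leq_ltn_trans sm mn).
rewrite [in leRHS]uE /prefix_dot sublist_dotDl !sublist_dotDr.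
rewrite (sublist_dotC _ low (degree_ge _ _)) (sublist_dot_disjoint _ d0) addr0 add0r.
by apply: lerD; apply: prefix_dot_le; rewrite ?leq_maxl ?leq_maxr.
Qed.

(** Hence the tail of [u] in high degrees is dominated by the tail of the convergent
    sequence of prefix sums. *)
Lemma fock_sqnorm_degree_ge_cvg e u (f : nat -> nat) :
  (forall n, (n < f n.+1)%N) -> (fock_sqnorm e u < +oo)%E ->
  (fun n => fock_sqnorm e (degree_ge (f n) u)) @ \oo --> 0%:E.
Proof.
move=> fn uoo; rewrite -cvg_shiftS/=.
have ufin : fock_sqnorm e u \is a fin_num.
  by rewrite ge0_fin_numE// fock_sqnorm_ge0.
pose h n := (fock_sqnorm e u - (prefix_dot e n u u)%:E)%E.
have h0 : h @ \oo --> 0%:E.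
  rewrite -[0%:E]/(0%E : \bar R) -(subee ufin); apply: cvgeB; first exact: fin_num_adde_defr.
    exact: cvg_cst.
  rewrite fock_sqnormE; apply: ereal_nondecreasing_cvgn => m n mn.
  by rewrite lee_fin prefix_dot_le.
apply: squeeze_cvge (cvg_cst 0%:E) h0; apply: nearW => n.
rewrite fock_sqnorm_ge0/=; apply: fock_sqnorm_le => M.
rewrite leeBrDr// -EFinD.
apply: le_trans (prefix_dot_le_sqnorm e (maxn n M) u).
by rewrite lee_fin prefix_dot_degree_ge.
Qed.

End fock_norm.

(** * Hilbert-Schmidt operators as forms of degree two *)

Section hilbert_schmidt_forms.
Variables (R : realType) (H : hilbertType R).
Local Notation form := (seq H -> R).
Implicit Types (u v w b : form) (h k x y : H) (s t r L : seq H).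

Lemma dot_cauchy_schwarz x y : `|dot x y| <= `|x| * `|y|.
Proof.
have [->|y0] := eqVneq y 0; first by rewrite dot0r !normr0 mulr0.
have n0 : `|y| != 0 by rewrite normr_eq0.
pose f := fun _ : 'I_1 => `|y|^-1 *: y.
have fo : Defs.orthonormal f.
  by move=> i j; rewrite !ord1 eqxx dotZl dotZr dot_norm expr2 mulKf ?mulVf.
have := bessel x fo; rewrite big_ord1 dotZr exprMn exprVn.
rewrite ler_pdivrMl ?exprn_gt0 ?normr_gt0// => xy.
by rewrite -ler_sqr ?nnegrE ?mulr_ge0// real_normK ?num_real// exprMn mulrC.
Qed.

Lemma dot_polarization x y : dot x y = 4^-1 * (`|x + y| ^+ 2 - `|x - y| ^+ 2).
Proof.
rewrite -!dot_norm !(dotDl, dotDr, dotNl, dotNr) (dotC y x); lra.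
Qed.

Lemma cvg_dot (f g : nat -> H) x y : f @ \oo --> x -> g @ \oo --> y ->
  (fun n => dot (f n) (g n)) @ \oo --> dot x y.
Proof.
move=> fx gy; rewrite dot_polarization; under eq_fun do rewrite dot_polarization.
have add : (fun n => `|f n + g n|) @ \oo --> `|x + y|.
  by exact: cvg_norm (cvgD fx gy).
have sub : (fun n => `|f n - g n|) @ \oo --> `|x - y|.
  by exact: cvg_norm (cvgB fx gy).
rewrite !expr2; under eq_fun do rewrite !expr2.
exact: cvgM (cvg_cst _) (cvgB (cvgM add add) (cvgM sub sub)).
Qed.

Lemma S2sk_linear (A : S2sk H) : linear A.
Proof. by have /S2skP[] := S2sk_valP A. Qed.

Lemma S2sk_skew (A : S2sk H) : skew_adjoint A.
Proof. by have /S2skP[] := S2sk_valP A. Qed.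

Lemma S2sk_ubound (A : S2sk H) : has_ubound (hs_sums A).
Proof. by have /S2skP[] := S2sk_valP A. Qed.

Lemma S2skD (A : S2sk H) x y : A (x + y) = A x + A y.
Proof. by have := S2sk_linear A 1 x y; rewrite !scale1r. Qed.

Lemma S2sk0 (A : S2sk H) : A 0 = 0.
Proof. by apply: (addrI (A 0)); rewrite -S2skD !addr0. Qed.

Lemma S2skZ (A : S2sk H) (a : R) x : A (a *: x) = a *: A x.
Proof. by have := S2sk_linear A a x 0; rewrite S2sk0 !addr0. Qed.

Lemma S2sk_sum (A : S2sk H) (I : Type) (r : seq I) (F : I -> H) :
  A (\sum_(i <- r) F i) = \sum_(i <- r) A (F i).
Proof. exact: (big_morph _ (S2skD A) (S2sk0 A)). Qed.

Lemma S2sk_norm_le (A : S2sk H) x : `|A x| <= hs_norm A * `|x|.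
Proof.
have [->|x0] := eqVneq x 0; first by rewrite S2sk0 !normr0 mulr0.
have n0 : `|x| != 0 by rewrite normr_eq0.
pose f := fun _ : 'I_1 => `|x|^-1 *: x.
have fo : Defs.orthonormal f.
  by move=> i j; rewrite !ord1 eqxx dotZl dotZr dot_norm expr2 mulKf ?mulVf.
have := hs_norm_ge (S2sk_ubound A) fo; rewrite big_ord1 S2skZ.
rewrite ler_sqr ?nnegrE ?sqrtr_ge0// normrZ normfV normr_id.
by rewrite ler_pdivrMl ?lt_neqAle 1?eq_sym ?n0 ?normr_ge0// mulrC.
Qed.

Lemma cvg_S2sk (A : S2sk H) (f : nat -> H) x :
  f @ \oo --> x -> (fun n => A (f n)) @ \oo --> A x.
Proof.
move=> fx; apply/cvgrPdist_le => eps eps0.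
have c0 : 0 < hs_norm A + 1 by rewrite ltr_wpDl ?sqrtr_ge0.
near=> n.
have -> : A x - A (f n) = A (x - f n).
  by rewrite -(scaleN1r (f n)) S2skD S2skZ scaleN1r.
apply: (le_trans (S2sk_norm_le A _)).
apply: (@le_trans _ _ ((hs_norm A + 1) * `|x - f n|)).
  by rewrite ler_wpM2r// lerDl.
rewrite -ler_pdivlMl// mulrC.
near: n; move/cvgrPdist_le: fx; apply; exact: divr_gt0.
Unshelve. all: by end_near.
Qed.

(** As [A] is skew, the sum over i < j of the antisymmetrized terms is the full
    double sum over i, j < n. *)
Lemma alpha_partial_sum (e : nat -> H) (A : S2sk H) h k n :
  \sum_(j < n) \sum_(i < j)
    dot (A (e j)) (e i) * wedge (vec (e i)) (vec (e j)) [:: h; k] =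
  dot (A (\sum_(j < n) dot k (e j) *: e j)) (\sum_(i < n) dot h (e i) *: e i).
Proof.
elim: n => [|n IH]; first by rewrite !big_ord0 dot0r.
rewrite !big_ord_recr/= IH S2skD !(dotDl, dotDr) -!addrA; congr (_ + _).
rewrite !S2skZ !(dotZl, dotZr) S2sk_sum dot_suml dot_sumr !mulr_sumr.
have -> : dot (A (e n)) (e n) = 0.
  by have := S2sk_skew A (e n) (e n); rewrite (dotC (e n)); lra.
rewrite !mulr0 addr0 -big_split/=; apply: eq_bigr => i _.
rewrite vec_wedgeE S2skZ !(dotZl, dotZr) (S2sk_skew A (e i)) (dotC (e i) (A _)).
rewrite !(dotC (e _) h) !(dotC (e _) k); ring.
Qed.

(** The closed formula shows that [alpha e A] does not depend on [e], and that its
    contraction by [h] is the vector [- A h]. *)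
Lemma alphaE (e : nat -> H) (A : S2sk H) s : orthonormal_basis e ->
  alpha e A s = if s is [:: h; k] then dot (A k) h else 0.
Proof.
case=> _ _ ebasis; have z : (forall i j, wedge (vec (e i)) (vec (e j)) s = 0) ->
    alpha e A s = 0.
  move=> w0; rewrite /alpha; apply: (@lim_near_cst R^o) => //; apply: nearW => n.
  by rewrite big1// => j _; rewrite big1// => i _; rewrite w0 mulr0.
case: s z => [|h [|k [|l s]]] z; try by apply: z => i j; rewrite vec_wedgeE.
rewrite /alpha; apply/cvg_lim => //; under eq_fun do rewrite alpha_partial_sum.
by apply: cvg_dot; [apply: cvg_S2sk; exact: ebasis|exact: ebasis].
Qed.

(** The zero vectors that pad the basis are discarded, so that the bounds stated
    for orthonormal families apply. *)
Lemma orthonormal_basis_prefix (e : nat -> H) n : orthonormal_basis e ->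
  exists m (f : 'I_m -> H), Defs.orthonormal f /\
    forall F : H -> R, F 0 = 0 ->
      \sum_(h <- [seq e i | i <- iota 0 n]) F h = \sum_i F (f i).
Proof.
case=> eo e01 _; pose I := [seq i <- iota 0 n | e i != 0].
have uI : uniq I by rewrite filter_uniq// iota_uniq.
exists (size I), (fun i => e (nth 0%N I i)); split=> [i j|F F0].
  have [->|ij] := eqVneq i j; last first.
    by rewrite eo// nth_uniq.
  have : nth 0%N I j \in I by exact: mem_nth.
  rewrite mem_filter => /andP[ej _]; case: (e01 (nth 0%N I j)) => [/eqP|].
    by rewrite (negbTE ej).
  by rewrite dot_norm => ->; rewrite expr1n.
rewrite big_map -(big_mkord xpredT (fun i => F (e (nth 0%N I i)))).
rewrite -(big_nth 0%N xpredT (fun i => F (e i))) big_filter [RHS]big_mkcond/=.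
by apply: eq_bigr => i _; case: eqP => // ->.
Qed.

Lemma bessel_prefix (e : nat -> H) n x : orthonormal_basis e ->
  \sum_(h <- [seq e i | i <- iota 0 n]) dot x h ^+ 2 <= `|x| ^+ 2.
Proof.
move=> /(orthonormal_basis_prefix n)[m [f [fo sumE]]].
by rewrite (sumE (fun h => dot x h ^+ 2)) ?bessel// dot0r expr0n.
Qed.

Lemma sublist_dot_le_sum L b (w : H -> H) (c : H -> R) : b [::] = 0 ->
  (forall h, contract h b = vec (w h)) ->
  (forall h, \sum_(k <- L) dot (w h) k ^+ 2 <= c h) ->
  sublist_dot L b b <= \sum_(h <- L) c h.
Proof.
move=> b0 bw; elim: L => [|h L IH] Lc /=; first by rewrite b0 mulr0 big_nil.
have Lc' k : \sum_(l <- L) dot (w k) l ^+ 2 <= c k.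
  by apply: le_trans (Lc k); rewrite big_cons lerDr sqr_ge0.
by rewrite big_cons addrC lerD ?IH// bw sublist_dot_vec.
Qed.

Section skew_form.
Variables (e : nat -> H) (onb_e : orthonormal_basis e) (A : S2sk H).

Lemma contract_alpha h : contract h (alpha e A) = vec (- A h).
Proof.
apply/funext => s; rewrite /contract alphaE//.
by case: s => [|k [|? ?]]//=; rewrite S2sk_skew dotNl dotC.
Qed.

Lemma alpha_nil : alpha e A [::] = 0.
Proof. by rewrite alphaE. Qed.

Lemma supported_alpha : supported (pred1 2%N) (alpha e A).
Proof. by move=> s; rewrite alphaE//; case: s => [|? [|? [|? ?]]]. Qed.

Lemma regular_alpha : regular_form (alpha e A).
Proof.
split.
- case=> [|h [|k s]] t a x y; rewrite !alphaE//=.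
  + by case: t => [|l [|? ?]]; rewrite ?mulr0 ?addr0// dotDr dotZr.
  + by case: t => [|? ?]; rewrite ?mulr0 ?addr0// S2sk_linear dotDl dotZl.
  + by case: s; rewrite /= ?mulr0 ?addr0.
- move=> s t r x; rewrite alphaE//; case: s => [|? [|? [|? ?]]]; case: t => [|? [|? ?]]//=.
  case: r => //=; have := S2sk_skew A x x; rewrite (dotC x); lra.
- move=> n; exists (hs_norm A) => s _; rewrite alphaE//.
  have ge0 : 0 <= hs_norm A * \prod_(x <- s) `|x|.
    by rewrite mulr_ge0 ?sqrtr_ge0 ?prodr_ge0.
  case: s ge0 => [|h [|k [|l s]]]; rewrite ?normr0// => _.
  rewrite !big_cons big_nil mulr1 (le_trans (dot_cauchy_schwarz _ _))//.
  by rewrite [`|h| * _]mulrC mulrA ler_wpM2r// S2sk_norm_le.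
Qed.

(** Bessel's inequality bounds each row of the matrix of [A] in the basis. *)
Lemma fock_sqnorm_alpha_le : (fock_sqnorm e (alpha e A) <= (hs_norm A ^+ 2)%:E)%E.
Proof.
apply: fock_sqnorm_le => n; rewrite lee_fin.
apply: (@le_trans _ _ (\sum_(h <- [seq e i | i <- iota 0 n]) `|A h| ^+ 2)).
  apply: (sublist_dot_le_sum alpha_nil contract_alpha) => h.
  by rewrite -[`|A h|]normrN; exact: bessel_prefix.
have [m [f [fo ->]]] := orthonormal_basis_prefix n onb_e.
  exact: hs_norm_ge (S2sk_ubound A) fo.
by rewrite S2sk0 normr0 expr0n.
Qed.

End skew_form.

Lemma regular_vec x : regular_form (vec x).
Proof.
split.
- case=> [|h s] t a y z /=.
    by case: t => [|? ?]; rewrite ?mulr0 ?addr0// dotDr dotZr.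
  by case: s => [|? ?]; rewrite /= mulr0 addr0.
- by case=> [|? [|? ?]] [|? ?] r y.
- move=> n; exists `|x| => s _.
  have ge0 : 0 <= `|x| * \prod_(y <- s) `|y| by rewrite mulr_ge0 ?prodr_ge0.
  case: s ge0 => [|h [|k s]] /=; rewrite ?normr0// => _.
  by rewrite big_cons big_nil mulr1 dot_cauchy_schwarz.
Qed.

Lemma vec_inj : injective (@vec R H).
Proof.
move=> x y xy; apply: dot_inj => z.
by have := congr1 (fun u : form => u [:: z]) xy; rewrite /= !(dotC z).
Qed.

Lemma alpha_inj e : orthonormal_basis e ->
  injective (fun A : S2sk H => alpha e A).
Proof.
move=> onb_e A B AB; apply/val_inj/funext => k; apply: dot_inj => h.
have := congr1 (fun u : form => u [:: h; k]) AB.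
by rewrite !alphaE// !(dotC h).
Qed.

End hilbert_schmidt_forms.

(** * The encoding *)

Section encoding.
Variables (R : realType) (H : hilbertType R) (e : nat -> H).
Hypothesis onb_e : orthonormal_basis e.
Local Notation form := (seq H -> R).
Implicit Types (x y : H) (A B : S2sk H) (u b : form) (s : seq H).

Local Notation double_alpha A := ((2 : R) *: alpha e A).

Lemma double_alpha_nil A : double_alpha A [::] = 0.
Proof. by rewrite fctE alpha_nil// scaler0. Qed.

Lemma supported_double_alpha A : supported (pred1 2%N) (double_alpha A).
Proof. by apply: supportedZ; exact: supported_alpha. Qed.

Lemma even_double_alpha A : parity (double_alpha A) = double_alpha A.
Proof. exact: supported2_even (supported_double_alpha A). Qed.

Lemma regular_generator x A : regular_form (generator e (x, A)).
Proof.
by apply: regularD (regular_vec x) _; apply: regularZ; exact: regular_alpha.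
Qed.

Lemma generator_nil x A : generator e (x, A) [::] = 0.
Proof. by rewrite /generator fctE double_alpha_nil addr0. Qed.

Lemma EncE x A : Enc e (x, A) =
  wexp (double_alpha A) + wedge (vec x) (wexp (double_alpha A)).
Proof. by apply: wexp_vecD; [exact: even_double_alpha|exact: double_alpha_nil]. Qed.

Lemma regular_Enc x A : regular_form (Enc e (x, A)).
Proof. by apply: regular_wexp; [exact: regular_generator|exact: generator_nil]. Qed.

(** The even part G of the encoding is an exponential, its odd part is x /\ G;
    they are orthogonal and the odd part costs the factor |x|^2. *)
Lemma prefix_dot_Enc_le n x A :
  prefix_dot e n (Enc e (x, A)) (Enc e (x, A)) <=
  (1 + `|x| ^+ 2) * expR (4 * prefix_dot e n (alpha e A) (alpha e A)).
Proof.
rewrite EncE; set G := wexp _.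
have Ge : parity G = G by apply: even_wexp; rewrite ?even_double_alpha ?double_alpha_nil.
have Ga : antisymmetric_form G.
  apply/regular_antisymmetric/regular_wexp; last exact: double_alpha_nil.
  by apply: regularZ; exact: regular_alpha.
rewrite /prefix_dot; set L := map _ _.
have even_odd : sublist_dot L G (wedge (vec x) G) = 0.
  by apply: sublist_dot_even_odd => //; rewrite parity_wedge Ge parity_vec wedgeNl.
rewrite sublist_dotDl !sublist_dotDr (sublist_dotC _ (wedge _ _) G) even_odd.
rewrite add0r addr0.
have Gle : sublist_dot L G G <= expR (4 * sublist_dot L (alpha e A) (alpha e A)).
  have -> : 4 * sublist_dot L (alpha e A) (alpha e A) =
      sublist_dot L (double_alpha A) (double_alpha A).
    by rewrite sublist_dotZl sublist_dotZr mulrA -natrM.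
  apply: (@sublist_dot_wexp_le _ _ _ _ (fun h => - (2 : R) *: A h)) => //.
  - exact: even_double_alpha.
  - exact: double_alpha_nil.
  - move=> h; rewrite contractZ contract_alpha//; apply/funext => s.
    by case: s => [|k [|? ?]]; rewrite !fctE/= ?scaler0// scaleNr -scalerN dotZl.
apply: (@le_trans _ _ ((1 + `|x| ^+ 2) * sublist_dot L G G)); last first.
  by rewrite ler_wpM2l// addr_ge0 ?sqr_ge0.
rewrite mulrDl mul1r lerD2l (le_trans (sublist_dot_vec_wedge_le L x Ga))//.
by rewrite ler_wpM2r ?sublist_dot_ge0// bessel_prefix.
Qed.

Lemma fock_sqnorm_Enc_le x A : (fock_sqnorm e (Enc e (x, A)) <=
  (1 + `|x| ^+ 2)%:E * expeR (4%:E * fock_sqnorm e (alpha e A)))%E.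
Proof.
apply: fock_sqnorm_le => n.
apply: (@le_trans _ _ ((1 + `|x| ^+ 2)%:E *
    expeR (4%:E * (prefix_dot e n (alpha e A) (alpha e A))%:E))%E).
  by rewrite -EFinM /= lee_fin prefix_dot_Enc_le.
apply: lee_wpmul2l; first by rewrite lee_fin addr_ge0 ?sqr_ge0.
rewrite lee_expeR; apply: lee_wpmul2l; first by rewrite lee_fin.
exact: prefix_dot_le_sqnorm.
Qed.

Lemma fock_sqnorm_Enc_lty x A : (fock_sqnorm e (Enc e (x, A)) < +oo)%E.
Proof.
apply: le_lt_trans (fock_sqnorm_Enc_le x A) _.
have afin : fock_sqnorm e (alpha e A) \is a fin_num.
  rewrite ge0_fin_numE ?fock_sqnorm_ge0//.
  by apply: le_lt_trans (fock_sqnorm_alpha_le onb_e A) _; rewrite ltry.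
by rewrite -(fineK afin) -EFinM/= ltry.
Qed.

Lemma fock_Enc x A : fock e (Enc e (x, A)).
Proof. by have [? ? ?] := regular_Enc x A; split=> //; exact: fock_sqnorm_Enc_lty. Qed.

(** The n-th power of x + 2 alpha is (2 alpha)^n + n x (2 alpha)^(n-1). *)
Lemma supported_wpow_generator x A n :
  supported [pred k | (2 * n).-1 <= k <= 2 * n]%N (wpow (generator e (x, A)) n).
Proof.
case: n => [|n]; first by case.
have bn m := @supported_wpow2 _ _ _ m (@supported_double_alpha A).
rewrite /generator wpow_vecD; last exact: even_double_alpha.
apply: supportedD.
  by apply: supportedW (bn n.+1) => k /eqP -> /=; apply/andP; split; lia.
apply: supportedZ; apply: (supported_wedge _ (@supported_vec _ _ x) (bn n)).
by move=> i j /eqP -> /eqP ->; rewrite /=; apply/andP; split; lia.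
Qed.

(** The n-th partial sum consists of the homogeneous components of degree less
    than 2n - 1. For n = 0 the truncated predecessor gives the correct bound 0. *)
Lemma Enc_sub_partial_sum n x A :
  Enc e (x, A) - series (exp_terms (generator e (x, A))) n =
  degree_ge (2 * n).-1 (Enc e (x, A)).
Proof.
apply/funext => s; rewrite !fctE /degree_ge.
have -> : series (exp_terms (generator e (x, A))) n s =
    \sum_(k < n) (k`!%:R)^-1 * wpow (generator e (x, A)) k s.
  by rewrite /series/= big_mkord fct_sumE.
case: ltnP => sn.
- rewrite /Enc (wexpE (generator_nil x A) (N := n + (size s).+1)); last by lia.
  rewrite big_split_ord/= addrC addKr big1// => k _.
  rewrite (@supported_wpow_generator x A) ?mulr0//= negb_and -ltnNge.
  by apply/orP; left; lia.
- rewrite big1 ?subr0// => k _.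
  rewrite (@supported_wpow_generator x A) ?mulr0//= negb_and -!ltnNge.
  by apply/orP; right; have := ltn_ord k; lia.
Qed.

Lemma Enc_series_cvg x A :
  (fun n => fock_sqnorm e
     (Enc e (x, A) - series (exp_terms (generator e (x, A))) n)) @ \oo --> 0%:E.
Proof.
under eq_fun do rewrite Enc_sub_partial_sum.
apply: (fock_sqnorm_degree_ge_cvg (f := fun n => (2 * n).-1)).
  by move=> n; lia.
exact: fock_sqnorm_Enc_lty.
Qed.

Lemma sum_supported (F : nat -> form) d N s M :
  (forall k, supported (pred1 (2 * k + d)%N) (F k)) ->
  size s = (2 * N + d)%N -> (N < M)%N ->
  \sum_(k < M) (k`!%:R)^-1 * F k s = (N`!%:R)^-1 * F N s.
Proof.
move=> Fd sN NM; rewrite (bigD1 (Ordinal NM))//= big1 ?addr0// => k kN.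
rewrite Fd ?mulr0// sN/=; apply: contra kN => /eqP kN; apply/eqP/val_inj => /=.
by lia.
Qed.

Lemma sum_supported0 (F : nat -> form) d N s M :
  (forall k, supported (pred1 (2 * k + d)%N) (F k)) ->
  size s = N -> odd N != odd d -> \sum_(k < M) (k`!%:R)^-1 * F k s = 0.
Proof.
move=> Fd sN Nd; rewrite big1// => k _.
rewrite Fd ?mulr0// sN/=; apply: contra Nd => /eqP ->; apply/eqP; lia.
Qed.

Lemma wpowZ a u n : wpow (a *: u) n = a ^+ n *: wpow u n.
Proof.
elim: n => [|n IH]; first by rewrite expr0 scale1r.
by rewrite !wpowS IH wedgeZl wedgeZr scalerA -exprS.
Qed.

Lemma supported_wexp_term A k :
  supported (pred1 (2 * k + 0)%N) (wpow (double_alpha A) k).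
Proof. by rewrite addn0; apply: supported_wpow2; exact: supported_double_alpha. Qed.

Lemma supported_vec_wexp_term x A k :
  supported (pred1 (2 * k + 1)%N) (wedge (vec x) (wpow (double_alpha A) k)).
Proof.
apply: supported_wedge (@supported_vec _ _ x) (@supported_wexp_term A k) => i j.
by move=> /eqP -> /eqP ->; rewrite /= addn0 addnC.
Qed.

Lemma Enc_even N x A : hcomp (2 * N)%N (Enc e (x, A)) =
  (2 ^+ N / N`!%:R : R) *: wpow (alpha e A) N.
Proof.
apply/funext => s; rewrite /hcomp; case: eqP => sN; last first.
  rewrite fctE (@supported_wpow2 _ _ _ N (@supported_alpha _ _ _ onb_e A)) ?scaler0//.
  exact/eqP.
rewrite EncE -[LHS]/(wexp _ s + wedge _ (wexp _) s).
have sM : (size s < N + (size s).+1)%N by lia.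
rewrite (wexpE (double_alpha_nil A) sM) (wedge_wexp _ (double_alpha_nil A) sM).
rewrite (@sum_supported _ 0 N _ _ (@supported_wexp_term A)) ?addn0//; last by lia.
rewrite (@sum_supported0 _ 1 _ _ _ (@supported_vec_wexp_term x A) sN); last first.
  by rewrite oddM.
by rewrite addr0 wpowZ !fctE /GRing.scale/= mulrA [_ * 2 ^+ N]mulrC.
Qed.

Lemma Enc_odd N x A : hcomp (2 * N + 1)%N (Enc e (x, A)) =
  (2 ^+ N / N`!%:R : R) *: wedge (vec x) (wpow (alpha e A) N).
Proof.
have a2 := @supported_wpow2 _ _ _ N (@supported_alpha _ _ _ onb_e A).
apply/funext => s; rewrite /hcomp; case: eqP => sN; last first.
  rewrite fctE (@supported_wedge _ _ _ _ (pred1 (2 * N + 1)%N) _ _ _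
    (@supported_vec _ _ x) a2) ?scaler0//; last exact/eqP.
  by move=> i j /eqP -> /eqP ->; rewrite /= addnC.
rewrite EncE -[LHS]/(wexp _ s + wedge _ (wexp _) s).
have sM : (size s < N + (size s).+1)%N by lia.
rewrite (wexpE (double_alpha_nil A) sM) (wedge_wexp _ (double_alpha_nil A) sM).
rewrite (@sum_supported0 _ 0 _ _ _ (@supported_wexp_term A) sN); last first.
  by rewrite oddD oddM.
rewrite (@sum_supported _ 1 N _ _ (@supported_vec_wexp_term x A))//; last by lia.
by rewrite add0r wpowZ wedgeZr !fctE /GRing.scale/= mulrA [_ * 2 ^+ N]mulrC.
Qed.

Lemma hcomp1_Enc x A : hcomp 1%N (Enc e (x, A)) = vec x.
Proof.
by rewrite (Enc_odd 0) /= wedge1r expr0 fact0 invr1 mulr1 scale1r.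
Qed.

Lemma hcomp2_Enc x A : hcomp 2%N (Enc e (x, A)) = double_alpha A.
Proof. by rewrite (Enc_even 1) wpow1 invr1 mulr1 expr1. Qed.

Lemma coord12_Enc x A : coord12 e (Enc e (x, A)) = (x, A).
Proof.
rewrite /coord12 hcomp1_Enc hcomp2_Enc; congr pair.
  by case: xgetP => [y _ /= /vec_inj ->//|/(_ x)[]].
case: xgetP => [B _ /= /scalerI AB|/(_ A)[]//].
by apply/esym/(alpha_inj onb_e); apply: AB; rewrite pnatr_eq0.
Qed.

Lemma double_alphaD A B : double_alpha (A + B) = double_alpha A + double_alpha B.
Proof.
apply/funext => s; rewrite !fctE !alphaE//.
by case: s => [|h [|k [|? ?]]]; rewrite ?scaler0 ?addr0// -scalerDr dotDl.
Qed.

(** This is why the group law carries the antisymmetrized tensor. *)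
Lemma double_alpha_Anti_tensor x y :
  double_alpha (Anti_tensor x y) = wedge (vec x) (vec y).
Proof.
apply/funext => s; rewrite !fctE alphaE// vec_wedgeE.
case: s => [|h [|k [|? ?]]]; rewrite ?scaler0//.
rewrite -[Anti_tensor x y k]/(Anti (tensor x y) k) Anti_tensorE dotZl dotBl !dotZl.
by rewrite /GRing.scale/=; field.
Qed.

Lemma Enc_star (p q : H * S2sk H) : Enc e (star p q) = wedge (Enc e p) (Enc e q).
Proof.
case: p q => [x A] [y B].
rewrite -[LHS]/(wexp (vec (x + y) + double_alpha (A + B + Anti_tensor x y))).
rewrite (double_alphaD (A + B)) (double_alphaD A) double_alpha_Anti_tensor.
by apply: wexp_vecD_mul; [exact: even_double_alpha|exact: double_alpha_nil
  |exact: even_double_alpha|exact: double_alpha_nil].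
Qed.

End encoding.

(** * Topological groups *)

Section topological_group_constructions.

Lemma continuous_pair (T U V : topologicalType) (f : T -> U) (g : T -> V) :
  continuous f -> continuous g -> continuous (fun t => (f t, g t)).
Proof. by move=> fc gc t; apply: cvg_pair; [exact: fc|exact: gc]. Qed.

Lemma continuous_fst (T U : topologicalType) : continuous (@fst T U).
Proof. by move=> t; exact: cvg_fst. Qed.

Lemma continuous_snd (T U : topologicalType) : continuous (@snd T U).
Proof. by move=> t; exact: cvg_snd. Qed.

Lemma continuous_compose (T U V : topologicalType) (f : T -> U) (g : U -> V) :
  continuous f -> continuous g -> continuous (g \o f).
Proof. by move=> fc gc t; apply: continuous_comp; [exact: fc|exact: gc]. Qed.

(** A homeomorphism that is multiplicative carries the group structure over: the
    operations of the target are conjugates of those of the source. *)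
Lemma topological_group_iso_transport (T U : topologicalType)
    (mulT : T -> T -> T) (mulU : U -> U -> U) (f : T -> U) (g : U -> T) :
  topological_group mulT -> cancel f g -> cancel g f ->
  continuous f -> continuous g -> {morph f : p q / mulT p q >-> mulU p q} ->
  topological_group_iso mulT mulU f.
Proof.
move=> Tgrp fK gK fc gc fmorph.
have mulUE u v : mulU u v = f (mulT (g u) (g v)) by rewrite fmorph !gK.
have [mulA [one [inv [[mul1 mulr1 mulV mulrV] [mulc invc]]]]] := Tgrp.
split=> //; last 2 first.
- by exists g.
- by split=> //; split; [exact: can_inj fK|exists g => //; exact: continuous_subspaceT].
split; first by move=> u v w; rewrite !mulUE !fK mulA.
exists (f one), (f \o inv \o g); split; [split|split].
- by move=> u; rewrite mulUE fK mul1 gK.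
- by move=> u; rewrite mulUE fK mulr1 gK.
- by move=> u; rewrite mulUE/= fK mulV.
- by move=> u; rewrite mulUE/= fK mulrV.
- have -> : (fun p : U * U => mulU p.1 p.2) =
      f \o (fun p : T * T => mulT p.1 p.2) \o (fun p : U * U => (g p.1, g p.2)).
    by apply/funext => p; rewrite mulUE.
  apply: continuous_compose; last exact: continuous_compose.
  by apply: continuous_pair; apply: continuous_compose gc;
    [exact: continuous_fst|exact: continuous_snd].
- by apply: continuous_compose => //; exact: continuous_compose.
Qed.

Lemma topological_group_prod (T U : topologicalType)
    (mulT : T -> T -> T) (mulU : U -> U -> U) :
  topological_group mulT -> topological_group mulU ->
  topological_group (fun p q : T * U => (mulT p.1 q.1, mulU p.2 q.2)).
Proof.
move=> [TA [oT [iT [[T1 Tr1 TV TrV] [Tc iTc]]]]].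
move=> [UA [oU [iU [[U1 Ur1 UV UrV] [Uc iUc]]]]].
split; first by move=> [? ?] [? ?] [? ?] /=; rewrite TA UA.
exists (oT, oU), (fun p => (iT p.1, iU p.2)); split; [split|split].
- by move=> [? ?] /=; rewrite T1 U1.
- by move=> [? ?] /=; rewrite Tr1 Ur1.
- by move=> [? ?] /=; rewrite TV UV.
- by move=> [? ?] /=; rewrite TrV UrV.
- apply: continuous_pair.
  + apply: (@continuous_compose _ _ _ (fun p : (T * U) * (T * U) => (p.1.1, p.2.1)) _ _ Tc).
    by apply: continuous_pair; apply: (continuous_compose _ (@continuous_fst _ _));
      [exact: continuous_fst|exact: continuous_snd].
  + apply: (@continuous_compose _ _ _ (fun p : (T * U) * (T * U) => (p.1.2, p.2.2)) _ _ Uc).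
    by apply: continuous_pair; apply: (continuous_compose _ (@continuous_snd _ _));
      [exact: continuous_fst|exact: continuous_snd].
- by apply: continuous_pair; [apply: continuous_compose iTc; exact: continuous_fst|
    apply: continuous_compose iUc; exact: continuous_snd].
Qed.

Lemma topological_group_add (R : numFieldType) (V : normedModType R) :
  topological_group (fun v w : V => v + w).
Proof.
split; first exact: addrA.
exists 0, -%R; split; [split|split].
- exact: add0r.
- exact: addr0.
- exact: addNr.
- exact: addrN.
- exact: add_continuous.
- exact: opp_continuous.
Qed.

End topological_group_constructions.

Section state_group.
Variables (R : realType) (H : hilbertType R).
Implicit Types (x y z : H) (A B : S2sk H).

Lemma Anti_tensorDl x y z :
  Anti_tensor (x + y) z = Anti_tensor x z + Anti_tensor y z.
Proof.
apply/val_inj/funext => h; rewrite -[RHS]/(Anti _ h + Anti _ h) /= !Anti_tensorE.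
by apply: dot_inj => k; rewrite !(dotDr, dotZr, dotNr, dotDl); ring.
Qed.

Lemma Anti_tensorN x y : Anti_tensor x y = - Anti_tensor y x.
Proof.
apply/val_inj/funext => h; rewrite -[RHS]/(- Anti _ h) /= !Anti_tensorE.
by apply: dot_inj => k; rewrite !(dotDr, dotZr, dotNr); ring.
Qed.

Lemma Anti_tensorDr x y z :
  Anti_tensor z (x + y) = Anti_tensor z x + Anti_tensor z y.
Proof. by rewrite Anti_tensorN Anti_tensorDl opprD -!Anti_tensorN. Qed.

Lemma Anti_tensorNl x y : Anti_tensor (- x) y = - Anti_tensor x y.
Proof.
apply/val_inj/funext => h; rewrite -[RHS]/(- Anti _ h) /= !Anti_tensorE.
by apply: dot_inj => k; rewrite !(dotDr, dotZr, dotNr, dotNl); ring.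
Qed.

Lemma Anti_tensorNr x y : Anti_tensor x (- y) = - Anti_tensor x y.
Proof. by rewrite Anti_tensorN Anti_tensorNl -Anti_tensorN. Qed.

Lemma Anti_tensor_diag x : Anti_tensor x x = 0.
Proof. by apply/val_inj/funext => h; rewrite /= Anti_tensorE subrr scaler0. Qed.

(** Parallelogram inequality for each term, then Bessel's inequality. *)
Lemma norm_Anti_tensor_le x y : `|Anti_tensor x y| <= `|x| * `|y|.
Proof.
rewrite -[leLHS]/(hs_norm (Anti_tensor x y)).
apply: hs_norm_le => [|n f fo]; first exact: mulr_ge0.
apply: (@le_trans _ _ (2^-1 * (`|x| ^+ 2 * \sum_i dot y (f i) ^+ 2 +
                               `|y| ^+ 2 * \sum_i dot x (f i) ^+ 2))).
  rewrite !mulr_sumr -big_split mulr_sumr ler_sum// => i _ /=.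
  have := sqr_ge0 `|dot y (f i) *: x + dot x (f i) *: y|.
  rewrite Anti_tensorE -!dot_norm !(dotDl, dotDr, dotNl, dotNr, dotZl, dotZr).
  rewrite (dotC y x); lra.
have := ler_wpM2l (sqr_ge0 `|x|) (bessel y fo).
have := ler_wpM2l (sqr_ge0 `|y|) (bessel x fo).
by rewrite exprMn; lra.
Qed.

Lemma continuous_Anti_tensor :
  continuous (fun p : H * H => Anti_tensor p.1 p.2).
Proof.
move=> p; apply/cvgrPdist_le => eps eps0.
pose m (q : H * H) := `|p.1 - q.1| * `|p.2| + `|q.1| * `|p.2 - q.2|.
have q1 : q.1 @[q --> p] --> p.1 by exact: cvg_fst.
have q2 : q.2 @[q --> p] --> p.2 by exact: cvg_snd.
have m0 : m q @[q --> p] --> (0 : R).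
  have d1 : `|p.1 - q.1| @[q --> p] --> `|p.1 - p.1|.
    exact: cvg_norm (cvgB (cvg_cst _) q1).
  have d2 : `|p.2 - q.2| @[q --> p] --> `|p.2 - p.2|.
    exact: cvg_norm (cvgB (cvg_cst _) q2).
  have := cvgD (cvgM d1 (cvg_cst `|p.2|)) (cvgM (cvg_norm q1) d2).
  by rewrite !subrr !normr0 mul0r mulr0 addr0; exact.
near=> q; apply: (@le_trans _ _ (m q)).
  have -> : Anti_tensor p.1 p.2 - Anti_tensor q.1 q.2 =
      Anti_tensor (p.1 - q.1) p.2 + Anti_tensor q.1 (p.2 - q.2).
    by rewrite Anti_tensorDl Anti_tensorDr Anti_tensorNl Anti_tensorNr addrA subrK.
  by rewrite (le_trans (ler_normD _ _))// lerD// norm_Anti_tensor_le.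
have : `|0 - m q| <= eps by near: q; move/cvgrPdist_le: m0; apply.
by rewrite sub0r normrN; apply: le_trans; exact: ler_norm.
Unshelve. all: by end_near.
Qed.

Lemma topological_group_star : topological_group (@star R H).
Proof.
split.
  move=> [x A] [y B] [z C]; rewrite /star/= addrA; congr pair.
  rewrite Anti_tensorDl Anti_tensorDr -!addrA; congr (_ + (_ + _)).
  by rewrite [RHS]addrCA (addrC (Anti_tensor y z)) -addrA.
exists (0, 0), (fun p => (- p.1, - p.2)).
have A0 x : Anti_tensor x 0 = 0.
  by apply: (addrI (Anti_tensor x 0)); rewrite -Anti_tensorDr !addr0.
split; [split|split].
- by move=> [x A]; rewrite /star/= !add0r (Anti_tensorN 0) A0 oppr0 addr0.
- by move=> [x A]; rewrite /star/= !addr0 A0 addr0.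
- by move=> [x A]; rewrite /star/= !addNr Anti_tensorNl Anti_tensor_diag oppr0 addr0.
- move=> [x A]; rewrite /star/= !addrN Anti_tensorNr Anti_tensor_diag.
  by rewrite oppr0 addr0.
- pose S := (H * S2sk H)%type.
  have f1 : continuous (fun p : S * S => p.1.1).
    by apply: (continuous_compose (@continuous_fst _ _)); exact: continuous_fst.
  have f2 : continuous (fun p : S * S => p.2.1).
    by apply: (continuous_compose (@continuous_snd _ _)); exact: continuous_fst.
  have s1 : continuous (fun p : S * S => p.1.2).
    by apply: (continuous_compose (@continuous_fst _ _)); exact: continuous_snd.
  have s2 : continuous (fun p : S * S => p.2.2).
    by apply: (continuous_compose (@continuous_snd _ _)); exact: continuous_snd.
  apply: continuous_pair => p; first by apply: cvgD; [exact: f1|exact: f2].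
  apply: cvgD; first by apply: cvgD; [exact: s1|exact: s2].
  exact: (continuous_compose (continuous_pair f1 f2) continuous_Anti_tensor).
- apply: continuous_pair => p; apply: cvgN; first exact: continuous_fst.
  exact: continuous_snd.
Qed.

Variables (e : nat -> H).
Hypothesis onb_e : orthonormal_basis e.

Definition G2_dec (g : G2 e) : H * S2sk H := coord12 e (G2_val g).

Lemma G2_encK : cancel (G2_enc e) G2_dec.
Proof. by case=> x A; exact: coord12_Enc. Qed.

Lemma G2_decK : cancel G2_dec (G2_enc e).
Proof.
move=> g; have [p _ pE] : G2_set e (G2_val g) by exact: set_mem (valP g).
have {pE} -> : g = G2_enc e p by apply: val_inj.
by rewrite G2_encK.
Qed.

Lemma continuous_G2_dec : continuous G2_dec.
Proof. exact: initial_continuous. Qed.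

Lemma continuous_G2_enc : continuous (G2_enc e).
Proof.
apply: continuous_comp_initial => p.
rewrite (_ : _ \o _ = id); first exact: cvg_id.
by apply/funext => q; exact: G2_encK.
Qed.

(** Transporting [star] makes [G2] a group at once; [G2_mulE] then says that the
    product so obtained is the exterior product. *)
Definition G2_mul (u v : G2 e) : G2 e := G2_enc e (star (G2_dec u) (G2_dec v)).

Lemma G2_mulE (u v : G2 e) : G2_val (G2_mul u v) = wedge (G2_val u) (G2_val v).
Proof.
have valE g : G2_val g = Enc e (G2_dec g) by rewrite -[in LHS](G2_decK g).
by rewrite (valE u) (valE v) -Enc_star.
Qed.

Lemma topological_group_iso_G2 :
  topological_group_iso (@star R H) G2_mul (G2_enc e).
Proof.
apply: topological_group_iso_transport.
- exact: topological_group_star.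
- exact: G2_encK.
- exact: G2_decK.
- exact: continuous_G2_enc.
- exact: continuous_G2_dec.
- by move=> p q; rewrite /G2_mul !G2_encK.
Qed.

Lemma topological_group_iso_G2_S1sa :
  topological_group_iso (@star3 R H)
    (fun u v : G2 e * S1sa H => (G2_mul u.1 v.1, u.2 + v.2))
    (fun s : H * S2sk H * S1sa H => (G2_enc e s.1, s.2)).
Proof.
apply: (topological_group_iso_transport
  (g := fun u : G2 e * S1sa H => (G2_dec u.1, u.2))).
- exact: topological_group_prod topological_group_star
    (@topological_group_add _ (S1sa H)).
- by case=> p q /=; rewrite G2_encK.
- by case=> g q /=; rewrite G2_decK.
- apply: continuous_pair; last exact: continuous_snd.
  by apply: continuous_compose continuous_G2_enc; exact: continuous_fst.
- apply: continuous_pair; last exact: continuous_snd.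
  by apply: continuous_compose continuous_G2_dec; exact: continuous_fst.
- by move=> s t; rewrite /G2_mul/= !G2_encK.
Qed.

End state_group.

Theorem theorem9p1 (R : realType) (H : hilbertType R) (sepH : separable H)
    (e : nat -> H) (onb_e : orthonormal_basis e) :
  (forall (x : H) (A : S2sk H),
     [/\ fock e (Enc e (x, A)),
         (fun n => fock_sqnorm e
            (Enc e (x, A) - series (exp_terms (generator e (x, A))) n))
           @ \oo --> 0%:E &
         (fock_sqnorm e (Enc e (x, A)) <=
            (1 + `|x| ^+ 2)%:E * expeR (4%:E * fock_sqnorm e (alpha e A)))%E])
  /\
  exists mulG : G2 e -> G2 e -> G2 e,
    (forall u v : G2 e, G2_val (mulG u v) = wedge (G2_val u) (G2_val v))
  /\
    [/\ forall p q : H * S2sk H,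
          Enc e (star p q) = wedge (Enc e p) (Enc e q),
        topological_group_iso (@star R H) mulG (G2_enc e) &
        forall (x : H) (A : S2sk H),
          [/\ hcomp 1%N (Enc e (x, A)) = vec x,
              hcomp 2%N (Enc e (x, A)) = (2 : R) *: alpha e A &
              coord12 e (Enc e (x, A)) = (x, A)]]
  /\
    [/\ forall (N : nat) (x : H) (A : S2sk H),
          hcomp (2 * N)%N (Enc e (x, A)) =
            (2 ^+ N / N`!%:R : R) *: wpow (alpha e A) N /\
          hcomp (2 * N + 1)%N (Enc e (x, A)) =
            (2 ^+ N / N`!%:R : R) *: wedge (vec x) (wpow (alpha e A) N),
        topological_group_iso (@star3 R H)
          (fun u v : G2 e * S1sa H => (mulG u.1 v.1, u.2 + v.2))
          (fun s : H * S2sk H * S1sa H => (G2_enc e s.1, s.2)) &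
        forall s t : H * S2sk H * S1sa H,
          G2_enc e s.1 = G2_enc e t.1 <-> exists q : S1sa H, t = (s.1, q)].
Proof.
split; first by move=> x A; split;
  [exact: fock_Enc|exact: Enc_series_cvg|exact: fock_sqnorm_Enc_le].
exists (@G2_mul R H e); split; first exact: G2_mulE.
split; first split.
- exact: Enc_star.
- exact: topological_group_iso_G2.
- by move=> x A; split; [exact: hcomp1_Enc|exact: hcomp2_Enc|exact: coord12_Enc].
split.
- by move=> N x A; split; [exact: Enc_even|exact: Enc_odd].
- exact: topological_group_iso_G2_S1sa.
- case=> [p q] [p' q']; split=> [/(can_inj (G2_encK onb_e))/= ->|[r [-> _]]//].
  by exists q'.
Qed.
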